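(* Let $n,a,b\ge 0$ and $m\ge 1$ be integers and set $N=n+a$. Let $\lambda$ be the strict partition with $N$ parts given by $\lambda=(n+a+b,\,n+a+b-1,\,\dots,\,b+1)+(m-1)\delta_{N}$, i.e. $\lambda_k=n+a+b+1-k+(m-1)(N-k)$ for $1\le k\le N$, and let $\pi=\lambda^\ast/(\delta_{a+1})^\ast$. Then the number $g^\pi$ of standard Young tableaux of shape $\pi$ is \[ g^\pi = \frac{|\pi|!}{2^a} \cdot \frac{\Phi(n+2a)\Phi(a)}{\Phi(2a)\Phi(n+a)} \cdot \frac{\gimel(2a)\gimel(n)}{\gimel(n+2a)} \prod_{(i,j)\in \lambda^\ast\setminus D}\frac{1}{h_{\lambda^*} (i,j)}, \] where $D$ is the set of cells $(i,n+j)$ with $1\le i\le j\le a$.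
   Context: $\Phi(k)=\prod_{i=1}^{k-1} i!$ and $\gimel(k)=\prod_{i=1}^{\lfloor k/2\rfloor}(k-2i)!$ (empty products equal $1$). $\delta_k=(k-1,k-2,\dots,1,0)$. For a strict partition $\nu$ (i.e. $\nu_1>\nu_2>\dots>\nu_{\ell}>0$), its shifted Young diagram is $\nu^\ast=\{(i,j): 1\le i\le \ell,\ i\le j\le \nu_i+i-1\}$; for strict $\kappa,\nu$ with $\kappa^\ast\subseteq\nu^\ast$, the shifted skew shape $\nu^\ast/\kappa^\ast$ is the set difference, and $|\pi|$ denotes the number of cells. A standard Young tableau of shape $\pi$ is a filling of its cells with $1,\dots,|\pi|$, each once, increasing along rows and down columns. Shifted hook lengths: if $\lambda$ is strict with $\ell(\lambda)=N$, write $\lambda=\delta_{N+1}+\mu$ with $\mu=(\mu_1,\dots,\mu_N)$ a partition; for $(i,j)\in\lambda^\ast$, $h_{\lambda^\ast}(i,j)=N+1+\mu_i$ if $i=j$; $h_{\lambda^\ast}(i,j)=\mu_i+\mu_j+2(N+1)-i-j$ if $i<j\le N$; and $h_{\lambda^\ast}(i,j)=h_\mu(i,j-N)$ if $j>N$, where $h_\mu(i,k)=\mu_i+\mu'_k-i-k+1$ is the ordinary hook length in the Young diagram of $\mu$ ($\mu'$ the conjugate partition).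
   Formalization: The diagonal hook is taken as N+1-i+μ_i (= λ_i) instead of the printed N+1+μ_i, with which the formula fails (e.g. λ=(1)); and the case n=0 with a≥1 is excluded, since there the right side equals g^π/2^a. *)

(* Defs.v *)
From mathcomp Require Import all_boot all_order all_algebra finmap.

Set Implicit Arguments.
Unset Strict Implicit.
Unset Printing Implicit Defensive.

Local Open Scope fset_scope.
Local Open Scope nat_scope.

Definition Phi (k : nat) : nat := \prod_(1 <= i < k) i`!.

Definition gimel (k : nat) : nat := \prod_(1 <= i < k./2.+1) (k - 2 * i)`!.

(* Partitions are sequences of parts, cells are pairs (row, column); rows,
   columns and parts are numbered from 1. *)
Definition part (nu : seq nat) (i : nat) : nat := nth 0 nu i.-1.

Definition delta (k : nat) : seq nat := [seq k - i | i <- iota 1 k].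

(* Row i consists of the columns i, ..., nu_i + i - 1; a trailing zero part, as
   in delta, contributes no cell. *)
Definition shifted_diagram (nu : seq nat) : {fset nat * nat} :=
  [fset c in [seq (i, j) | i <- iota 1 (size nu), j <- iota i (part nu i)]].

Definition shifted_skew (nu kappa : seq nat) : {fset nat * nat} :=
  shifted_diagram nu `\` shifted_diagram kappa.

(* The entry of the cell c is (t c).+1, which ranges over 1, ..., #|` p|.  An
   injective filling uses each of these #|` p| values exactly once. *)
Definition is_SYT (p : {fset nat * nat}) (t : {ffun p -> 'I_(#|` p|)}) : bool :=
  [&& injectiveb t,
      [forall c : p, forall d : p,
         ((val c).1 == (val d).1) && ((val c).2 < (val d).2) ==> (t c < t d)]
    & [forall c : p, forall d : p,
         ((val c).2 == (val d).2) && ((val c).1 < (val d).1) ==> (t c < t d)]].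

Definition num_SYT (p : {fset nat * nat}) : nat :=
  #|[set t : {ffun p -> 'I_(#|` p|)} | is_SYT t]|.

Definition conj_part (mu : seq nat) (k : nat) : nat := count (leq k) mu.

Definition hook (mu : seq nat) (i k : nat) : nat :=
  part mu i + conj_part mu k + 1 - (i + k).

(* The partition mu with la = delta_(N+1) + mu, for la strict with exactly N
   (positive) parts; then la_i >= N + 1 - i, so the subtraction is exact. *)
Definition unshift (la : seq nat) : seq nat :=
  [seq part la i - part (delta (size la).+1) i | i <- iota 1 (size la)].

(* On the cells of the shifted diagram of a strict la with positive parts all
   subtractions are exact.  The diagonal value N + 1 - i + mu_i is la_i; it sits
   at (i, i), and la_i + la_j at (i, j) for i < j <= N, which permutes within
   row i the usual placement of the shifted hook lengths. *)
Definition shifted_hook (la : seq nat) (c : nat * nat) : nat :=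
  let: (i, j) := c in
  let N := size la in
  let mu := unshift la in
  if i == j then N + 1 - i + part mu i
  else if j <= N then part mu i + part mu j + 2 * (N + 1) - i - j
  else hook mu i (j - N).

Definition lam (n a b m : nat) : seq nat :=
  [seq (n + a + b + 1 - k) + (m - 1) * (n + a - k) | k <- iota 1 (n + a)].

(* D meets the main diagonal only if n = 0.  In that case lam n a b m / delta_(a+1)
   is the straight shape mu, and for a > 0 the product formula with the factor
   1 / 2 ^ a fails (it gives 1 / 2 ^ a times the number of tableaux). *)
Definition Dcells (n a : nat) : {fset nat * nat} :=
  [fset c in [seq (i, n + j) | i <- iota 1 a, j <- iota i (a + 1 - i)]].

(* Main.v *)
(** Read the rows from the bottom: [x_j] is the length of row [N - j].  Let [D] be
    the alternant in the [x_j] with exponents [0, ..., n-1, n+1, n+3, ..., n+2a-1],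
    let [W = D / \prod_(i < j) (x_i + x_j)], and let [T_k] be the substitution of
    [x_k - 1] for [x_k].  For every strict partition the number of tableaux of
    [lambda^* / delta_(a+1)^*] is [|pi|! * W / \prod_j x_j!].  Indeed, removing the
    largest entry reduces this to the eigenvalue equation
    [\sum_k x_k T_k W = |pi| W].  The latter is proved by induction on [a] from
    [W_(a+1) x = \sum_j (+/-) x_j (x_j - 1) ... (x_j - a) W_a (x without x_j)];
    for [a = 0] it is an instance of Lagrange interpolation.

    If the [x_j] form an arithmetic progression, then taking centered differences
    [n] times turns [D] into the alternant with the odd exponents
    [1, 3, ..., 2a-1], which factors into sums [x_(n+i) + x_j]: these are the hook
    lengths in the cells of [Dcells n a], and so these cancel from the product of
    all hook lengths. *)

Require Import Defs.
From mathcomp Require Import all_boot all_order all_algebra finmap.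
From mathcomp Require Import ring lra zify.

Set Implicit Arguments.
Unset Strict Implicit.
Unset Printing Implicit Defensive.

Import Order.TTheory GRing.Theory Num.Theory.
Local Open Scope fset_scope.
Local Open Scope ring_scope.

(** * Products over pairs of indices, and splitting off one index *)

Lemma prod_bump (R : comPzRingType) (N k : nat) (f : nat -> R) : (k <= N)%N ->
  \prod_(j < N.+1) f j = f k * \prod_(j < N) f (bump k j).
Proof.
move=> kN; rewrite -ltnS in kN.
by rewrite (bigD1_ord (Ordinal kN)).
Qed.

Lemma sum_bump (V : nmodType) (N k : nat) (f : nat -> V) : (k <= N)%N ->
  \sum_(j < N.+1) f j = f k + \sum_(j < N) f (bump k j).
Proof.
move=> kN; rewrite -ltnS in kN.
by rewrite (bigD1_ord (Ordinal kN)).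
Qed.

Definition pairprod (R : comPzRingType) (N : nat) (g : nat -> nat -> R) : R :=
  \prod_(i < N) \prod_(j < i) g i j.

Lemma eq_pairprod (R : comPzRingType) N (g h : nat -> nat -> R) :
  (forall i j, (j < i < N)%N -> g i j = h i j) -> pairprod N g = pairprod N h.
Proof.
move=> gh; apply: eq_bigr => i _; apply: eq_bigr => j _; apply: gh.
by rewrite ltn_ord ltn_ord.
Qed.

Lemma pairprodS (R : comPzRingType) N (g : nat -> nat -> R) :
  pairprod N.+1 g = pairprod N g * \prod_(j < N) g N j.
Proof. by rewrite /pairprod big_ord_recr. Qed.

Lemma pairprod_neq0 (F : fieldType) N (g : nat -> nat -> F) :
  (forall i j, (j < i < N)%N -> g i j != 0) -> pairprod N g != 0.
Proof.
move=> gP; apply/prodf_neq0 => i _; apply/prodf_neq0 => j _; apply: gP.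
by rewrite !ltn_ord.
Qed.

Lemma pairprodM (R : comPzRingType) N (g h : nat -> nat -> R) :
  pairprod N (fun i j => g i j * h i j) = pairprod N g * pairprod N h.
Proof.
by rewrite /pairprod -big_split; apply: eq_bigr => i _; rewrite big_split.
Qed.

(** The [N - k] pairs in which [k] is the smaller index are turned around, each at the cost of a
    factor [c]; [c] is -1 for differences and 1 for sums. *)
Lemma pairprod_extract (R : comPzRingType) (c : R) N k (g : nat -> nat -> R) :
    (k <= N)%N -> (forall i j, g i j = c * g j i) ->
  pairprod N.+1 g = c ^+ (N - k) * \prod_(i < N) g k (bump k i)
                    * pairprod N (fun i j => g (bump k i) (bump k j)).
Proof.
move=> kN gc; elim: N kN => [|N IHN] kN.
  move: kN; rewrite leqn0 => /eqP->.
  by rewrite /pairprod big_ord1 !big_ord0 !mulr1.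
rewrite pairprodS; case: (ltnP k N.+1) => kN1; last first.
  have -> : k = N.+1 by apply/eqP; rewrite eqn_leq kN.
  rewrite subnn expr0 mul1r mulrC.
  have bumpE i : (i < N.+1)%N -> bump N.+1 i = i.
    by move=> iN; rewrite /bump leqNgt iN.
  congr (_ * _); first by apply: eq_bigr => i _; rewrite bumpE.
  apply: eq_pairprod => i j /andP[ji iN]; rewrite !bumpE //.
  exact: ltn_trans iN.
rewrite IHN // subSn // (prod_bump (k := k)) // exprS gc.
rewrite pairprodS (big_ord_recr N) /=.
have -> : bump k N = N.+1 by rewrite /bump -ltnS kN1.
ring.
Qed.

(** * Alternants with staircase exponents and their borderings *)

(* The exponents 0, ..., n-1, n+1, n+3, ... in increasing order. *)
Definition stair_exp (n k : nat) : nat := k + (k.+1 - n).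

Definition altdet (R : comPzRingType) (n N : nat) (x : nat -> R) : R :=
  \det (\matrix_(i < N, j < N) x j ^+ stair_exp n i).

Lemma eq_altdet (R : comPzRingType) n N (x y : nat -> R) :
  (forall i, (i < N)%N -> x i = y i) -> altdet n N x = altdet n N y.
Proof.
by move=> xy; congr (\det _); apply/matrixP => i j; rewrite !mxE xy.
Qed.

(** Laplace expansion, along the last row, of the alternant in [N.+1] variables with its last row
    replaced by [v]; recursions on the number of variables arise in this form. *)
Definition border (R : comPzRingType) (n N : nat) (x v : nat -> R) : R :=
  \sum_(j < N.+1) (-1) ^+ (N + j) * v j * altdet n N (fun i => x (bump j i)).

Lemma borderE (R : comPzRingType) n N (x v : nat -> R) :
  border n N x v =
  \det (\matrix_(i < N.+1, j < N.+1)
    if i == ord_max then v j else x j ^+ stair_exp n i).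
Proof.
rewrite (expand_det_row _ ord_max); apply: eq_bigr => j _.
rewrite !mxE eqxx /cofactor mulrA [v j * _]mulrC; congr (_ * _ * _).
congr (\det _); apply/matrixP => i k; rewrite !mxE /=.
have -> : lift ord_max i == ord_max = false.
  by apply/negbTE; rewrite eq_sym neq_lift.
have -> : bump N i = i by rewrite /bump leqNgt ltn_ord.
by [].
Qed.

Lemma border_exp_lt (R : comPzRingType) n N k (x : nat -> R) : (k < N)%N ->
  border n N x (fun j => x j ^+ stair_exp n k) = 0.
Proof.
move=> kN; rewrite borderE.
have kN1 : (k < N.+1)%N by rewrite ltnS ltnW.
rewrite (@determinant_alternate _ _ _ (Ordinal kN1) ord_max) //.
  by rewrite -val_eqE /= neq_ltn kN.
by move=> j; rewrite !mxE eqxx -val_eqE /= (ltn_eqF kN).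
Qed.

Lemma border_exp (R : comPzRingType) n N (x : nat -> R) :
  border n N x (fun j => x j ^+ stair_exp n N) = altdet n N.+1 x.
Proof.
rewrite borderE; congr (\det _); apply/matrixP => i j; rewrite !mxE.
by case: eqP => // ->.
Qed.

Lemma eq_border (R : comPzRingType) n N (x v w : nat -> R) :
  (forall j, (j <= N)%N -> v j = w j) -> border n N x v = border n N x w.
Proof.
by move=> vw; apply: eq_bigr => j _; rewrite vw // -ltnS.
Qed.

Lemma border_sum (R : comPzRingType) n N (x : nat -> R) I r (c : I -> R) v :
  border n N x (fun j => \sum_(i <- r) c i * v i j) =
  \sum_(i <- r) c i * border n N x (v i).
Proof.
rewrite /border.
under [RHS]eq_bigr do rewrite mulr_sumr.
rewrite exchange_big; apply: eq_bigr => j _ /=.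
move: (altdet _ _ _) => d; rewrite mulr_sumr mulr_suml; apply: eq_bigr => i _; ring.
Qed.

(** * Parity of exponents in bordered alternants *)

Definition rootpoly (R : comNzRingType) N (x : nat -> R) : {poly R} :=
  \prod_(i < N) ('X - (x i)%:P).

Lemma size_rootpoly (R : comNzRingType) N (x : nat -> R) :
  size (rootpoly N x) = N.+1.
Proof. by rewrite size_prod_XsubC /index_enum -enumT size_enum_ord. Qed.

Lemma rootpoly_lead (R : comNzRingType) N (x : nat -> R) :
  (rootpoly N x)`_N = 1.
Proof.
have := monic_prod_XsubC (index_enum 'I_N) xpredT (fun i => x i).
by rewrite monicE lead_coefE -[\prod_(i <- _) _]/(rootpoly N x) size_rootpoly
  => /eqP.
Qed.

Lemma horner_rootpoly (R : comNzRingType) N (x : nat -> R) z :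
  (rootpoly N x).[z] = \prod_(i < N) (z - x i).
Proof.
by rewrite horner_prod; apply: eq_bigr => i _; rewrite hornerXsubC.
Qed.

Lemma horner_rootpoly_root (R : comNzRingType) N (x : nat -> R) j :
  (j < N)%N -> (rootpoly N x).[x j] = 0.
Proof.
by move=> jN; rewrite horner_rootpoly (bigD1 (Ordinal jN)) //= subrr mul0r.
Qed.

(* Twice the left-hand side is [x_j ^+ p * \prod_i (x_j + x_i)]; adding or
   subtracting [x_j ^+ p * \prod_i (x_j - x_i) = 0] keeps one parity class. *)
Lemma parity_expansion (F : numFieldType) N (x : nat -> F) j p t : (j <= N)%N ->
  x j ^+ p.+1 * \prod_(i < N) (x j + x (bump j i)) =
  \sum_(i < N.+2) ((-1) ^+ (N.+1 + i) * (rootpoly N.+1 x)`_i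
     *+ (odd i == odd t)) * x j ^+ (i + p).
Proof.
move=> jN; have two0 : (2%:R : F) != 0 by rewrite pnatr_eq0.
apply: (mulfI two0); transitivity
  ((-1) ^+ N.+1 * x j ^+ p * ((rootpoly N.+1 x).[- x j]
      + (-1) ^+ t * (rootpoly N.+1 x).[x j])).
  rewrite horner_rootpoly_root // mulr0 addr0 horner_rootpoly.
  under [in RHS]eq_bigr => i _ do rewrite -opprD -mulN1r.
  rewrite big_split prodr_const card_ord /= [RHS]mulrACA.
  rewrite -expr2 sqrr_sign mul1r (prod_bump (fun i => x j + x i) jN) exprS; ring.
rewrite !horner_coef size_rootpoly [_ * \sum_(i < N.+2) _]mulr_sumr -big_split.
rewrite /= !mulr_sumr; apply: eq_bigr => i _.
rewrite (exprNn (x j)) exprD [x j ^+ (_ + _)]exprD.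
rewrite -[(-1) ^+ t]signr_odd -[(-1) ^+ i]signr_odd.
case: (odd t); case: (odd i); rewrite ?expr0 ?expr1 ?mulr0n ?mulr1n; ring.
Qed.

(** Below [n] the staircase omits nothing, and from [n] on it consists of the numbers with the
    parity of [n + 1]. The bound on [k] serves to place the exponent among the first rows of an
    alternant. *)
Lemma stair_exp_parity n e : odd e = odd n.+1 ->
  exists2 k, stair_exp n k = e & (k.*2 < e + n)%N.
Proof.
move=> eo; case: (ltnP e n) => en.
  by exists e; rewrite /stair_exp; lia.
by exists ((e + n).-1./2); rewrite /stair_exp; lia.
Qed.

(** Keep the parity class in which all exponents [i + p] have the parity of [n + 1]. Each of them
    then repeats a row of the alternant, except for the next staircase exponent [n + 2a + 1], which
    is reached only by the leading term and only if [p = a]. *)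
Lemma border_stair (F : numFieldType) n a p (x : nat -> F) : (p <= a)%N ->
  border n (n + a)
    x (fun j => x j ^+ p.+1 * \prod_(i < n + a) (x j + x (bump j i))) =
  altdet n (n + a).+1 x *+ (p == a).
Proof.
move=> pa; set N := (n + a)%N.
rewrite (eq_border n x (fun j jN => @parity_expansion F N x j p (n + p).+1 jN)).
rewrite border_sum big_ord_recr /= big1 ?add0r => [|i _]; last first.
  case: eqP => [oi|]; last by rewrite mulr0n mul0r.
  have [|k kE kle] := @stair_exp_parity n (i + p).
    by rewrite oddD oi /= oddD; case: (odd n); case: (odd p).
  rewrite (eq_border n x (w := fun j => x j ^+ stair_exp n k)); last first.
    by move=> j _; rewrite kE.
  rewrite border_exp_lt ?mulr0 //; have := ltn_ord i; rewrite /N in kle *; lia.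
rewrite rootpoly_lead mulr1 -signr_odd.
have -> : odd (N.+1 + N.+1) = false by lia.
case: (altP (p =P a)) => [->|pna].
  have -> : odd N.+1 == odd (n + a).+1 by rewrite eqxx.
  rewrite mul1r (eq_border n x (w := fun j => x j ^+ stair_exp n N)).
    by rewrite border_exp.
  by move=> j _; congr (_ ^+ _); rewrite /stair_exp /N; lia.
case: eqP => [oi|]; last by rewrite mulr0n mul0r.
have [|k kE kle] := @stair_exp_parity n (N.+1 + p).
  by rewrite oddD /= oi /= oddD; case: (odd n); case: (odd p).
rewrite (eq_border n x (w := fun j => x j ^+ stair_exp n k)); last first.
  by move=> j _; rewrite kE.
rewrite border_exp_lt ?mulr0 //; rewrite /N in kle *; lia.
Qed.

(** * Lagrange interpolation *)

Lemma lead_coef_interpolation (F : fieldType) N (y : nat -> F) (p : {poly F}) :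
    (forall i j, (i < j <= N)%N -> y i != y j) -> (size p <= N.+1)%N ->
  p`_N = \sum_(k < N.+1) p.[y k] / \prod_(i < N) (y k - y (bump k i)).
Proof.
move=> yD sp.
have neqy i j : (i <= N)%N -> (j <= N)%N -> i != j -> y i != y j.
  move=> iN jN; rewrite neq_ltn => /orP[ij|ji]; first by rewrite yD ?ij.
  by rewrite eq_sym yD ?ji.
have bumpN k i : (i < N)%N -> (bump k i <= N)%N by rewrite /bump; case: (k <= i)%N; lia.
have pk0 k : (k < N.+1)%N -> \prod_(i < N) (y k - y (bump k i)) != 0.
  move=> kN; apply/prodf_neq0 => i _; rewrite subr_eq0 neqy ?neq_bump //.
  exact: bumpN.
pose L k : {poly F} := rootpoly N (fun i => y (bump k i)).
have LE k j : (k < N.+1)%N -> (j < N.+1)%N -> k != j -> (L k).[y j] = 0.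
  move=> kN jN kj; rewrite -(unbumpK (h := k) (x := j)); last first.
    by rewrite inE eq_sym.
  by rewrite /L horner_rootpoly_root // /unbump; move: kj; case: ltngtP; lia.
suff {1}-> : p = \sum_(k < N.+1)
    (p.[y k] / \prod_(i < N) (y k - y (bump k i))) *: L k.
  rewrite coef_sum; apply: eq_bigr => k _.
  by rewrite coefZ rootpoly_lead mulr1.
(* The difference has degree at most [N] and vanishes at [N.+1] distinct points. *)
apply/eqP; rewrite -subr_eq0; apply/eqP.
apply: (@roots_geq_poly_eq0 _ _ [seq y i | i <- iota 0 N.+1]).
- apply/allP => z /mapP[j]; rewrite mem_iota add0n /= => jN ->.
  rewrite rootE !hornerE horner_sum (bigD1 (Ordinal jN)) //=.
  rewrite [X in _ - (_ + X)]big1 ?addr0.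
    by rewrite hornerZ /L horner_rootpoly mulfVK ?pk0 // subrr.
  by move=> k kj; rewrite hornerZ LE ?mulr0.
- rewrite map_inj_in_uniq ?iota_uniq // => i j.
  rewrite !mem_iota !add0n /= => iN jN /eqP.
  by apply: contraTeq => ij; rewrite neqy.
rewrite size_map size_iota (leq_trans (size_polyD _ _)) // geq_max sp size_polyN.
rewrite (leq_trans (size_sum _ _ _)) //; apply/bigmax_leqP => k _.
by rewrite (leq_trans (size_scale_leq _ _)) // size_rootpoly.
Qed.

Lemma rootpoly_subleading (R : comNzRingType) N (x : nat -> R) :
  (rootpoly N.+1 x)`_N = - \sum_(i < N.+1) x i.
Proof.
have := @coefPn_prod_XsubC R [seq x i | i : 'I_N.+1].
rewrite size_map -cardE card_ord !big_image /= => -> //.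
Qed.

(** With [y_i = x_i^2 - x_i] and [z_i = x_i^2 + x_i] one has
    [y_k - z_i = (x_k - 1 - x_i)(x_k + x_i)] and [y_k - y_i = (x_k - 1 + x_i)(x_k - x_i)].
    Interpolating the difference of the monic polynomials with roots [z_i] and [y_i] at the nodes
    [y_k] gives -2 times the claim. *)
Lemma sum_shift_ratio (F : realFieldType) N (x : nat -> F) :
    (forall i, (i <= N)%N -> 1 <= x i) ->
    (forall i j, (i < j <= N)%N -> x i != x j) ->
  \sum_(k < N.+1) x k * \prod_(i < N)
     ((x k - 1 - x (bump k i)) * (x k + x (bump k i)) /
      ((x k - 1 + x (bump k i)) * (x k - x (bump k i)))) =
  \sum_(i < N.+1) x i.
Proof.
move=> x1 xD; pose y i := x i ^+ 2 - x i; pose z i := x i ^+ 2 + x i.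
have yD i j : (i < j <= N)%N -> y i != y j.
  move=> ij; have /andP[ij' jN] := ij; rewrite -subr_eq0.
  have -> : y i - y j = (x i - x j) * (x i + x j - 1) by rewrite /y; ring.
  apply: mulf_neq0; first by rewrite subr_eq0 xD.
  apply: lt0r_neq0.
  have iN : (i <= N)%N by lia.
  by have := x1 i iN; have := x1 j jN; lra.
have neqx i j : (i <= N)%N -> (j <= N)%N -> i != j -> x i != x j.
  move=> iN jN; rewrite neq_ltn => /orP[ij|ji]; first by rewrite xD ?ij.
  by rewrite eq_sym xD ?ji.
have m20 : (- 2 : F) != 0 by rewrite oppr_eq0 pnatr_eq0.
apply: (mulfI m20).
have sz : (size (rootpoly N.+1 z - rootpoly N.+1 y)%R <= N.+1)%N.
  apply/leq_sizeP => j; rewrite leq_eqVlt => /predU1P[<-|jN].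
    by rewrite coefB !rootpoly_lead subrr.
  by rewrite coefB !nth_default ?subr0 // size_rootpoly.
have E := lead_coef_interpolation yD sz.
(* The coefficient of degree [N] is the sum of [y_i - z_i = - 2 x_i]; in the interpolation sum, the
   factor [y_k - z_k] supplies the weight [- 2 x_k]. *)
transitivity ((rootpoly N.+1 z - rootpoly N.+1 y)`_N); last first.
  rewrite coefB !rootpoly_subleading opprK mulr_sumr -sumrN -big_split /=.
  by apply: eq_bigr => i _; rewrite /y /z; ring.
rewrite E mulr_sumr; apply: eq_bigr => k _.
rewrite hornerD hornerN horner_rootpoly_root // subr0 horner_rootpoly.
have kN : (k <= N)%N by rewrite -ltnS.
rewrite (prod_bump (fun i => y k - z i) kN).
have -> : y k - z k = -2 * x k by rewrite /y /z; ring.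
rewrite -!mulrA; congr (_ * (_ * _)).
rewrite -prodf_div; apply: eq_bigr => i _; congr (_ / _); rewrite /y /z; ring.
Qed.

(** * The quotient of an alternant by the product of pair sums *)

Lemma altdet_Vandermonde (R : comPzRingType) N (x : nat -> R) :
  altdet N N x = pairprod N (fun i j => x i - x j).
Proof.
have := det_Vandermonde (\row_(j < N) x j); rewrite /altdet => E.
rewrite (_ : \matrix_(i, j) _ = Vandermonde N (\row_(j < N) x j)); last first.
  apply/matrixP => i j; rewrite !mxE /stair_exp.
  by rewrite (eqP (_ : i.+1 - N == 0)%N) ?subn_eq0 // addn0.
rewrite E (exchange_big_dep xpredT) //=; apply: eq_bigr => i _.
rewrite (big_ord_widen N (fun j => x i - x j)) ?(ltnW (ltn_ord _)) //.
by apply: eq_bigr => j _; rewrite !mxE.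
Qed.

(** The quotient [W] of the introductory comment, with the number [N] of variables left free. *)
Definition stair_ratio (F : fieldType) (n N : nat) (x : nat -> F) : F :=
  altdet n N x / pairprod N (fun i j => x i + x j).

Lemma eq_stair_ratio (F : fieldType) n N (x y : nat -> F) :
  (forall i, (i < N)%N -> x i = y i) -> stair_ratio n N x = stair_ratio n N y.
Proof.
move=> xy; congr (_ / _); first exact: eq_altdet.
by apply: eq_pairprod => i j /andP[ji iN]; rewrite !xy // (ltn_trans ji).
Qed.

(** Omitting [x_j] from the product of pair sums loses exactly the factors [x_j + x_i] that
    [border_stair] has in the bordering row. *)
Lemma stair_ratio_rec (F : numFieldType) n a p (x : nat -> F) : (p <= a)%N ->
    (forall i j, (i < j <= n + a)%N -> x i + x j != 0) ->
  \sum_(j < (n + a).+1) (-1) ^+ (n + a + j) * x j ^+ p.+1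
     * stair_ratio n (n + a) (fun i => x (bump j i)) =
  stair_ratio n (n + a).+1 x *+ (p == a).
Proof.
move=> pa x0; rewrite /stair_ratio -mulrnAl -border_stair // /border.
move E : (n + a)%N => N; rewrite E in x0.
set P := pairprod N.+1 _.
rewrite [RHS]mulr_suml; apply: eq_bigr => j _.
have jN : (j <= N)%N by rewrite -ltnS.
have P0 : P != 0.
  by apply: pairprod_neq0 => i k ik; rewrite addrC x0.
move: P0; rewrite /P (@pairprod_extract _ 1 _ j) // => [|i k]; last first.
  by rewrite mul1r addrC.
rewrite expr1n mul1r mulf_eq0 negb_or => /andP[A0 B0].
by field; apply/andP; split.
Qed.

Definition decr (R : pzRingType) (x : nat -> R) (k i : nat) : R :=
  x i - (i == k)%:R.

(** Here [W] is the product of the [(x_i - x_j) / (x_i + x_j)], and lowering [x_k] affects only the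
    factors with index [k]; division by [W] gives the summands of [sum_shift_ratio]. *)
Lemma stair_ratio_decr0 (F : realFieldType) n (x : nat -> F) :
    (forall i, (i < n)%N -> 1 <= x i) ->
    (forall i j, (i < j < n)%N -> x i != x j) ->
  \sum_(k < n) x k * stair_ratio n n (decr x k) =
  (\sum_(i < n) x i) * stair_ratio n n x.
Proof.
case: n => [|N] x1 xD; first by rewrite !big_ord0 mul0r.
rewrite -(sum_shift_ratio x1 xD) mulr_suml; apply: eq_bigr => k _.
have neqx i j : (i <= N)%N -> (j <= N)%N -> i != j -> x i != x j.
  move=> iN jN; rewrite neq_ltn => /orP[ij|ji]; first by rewrite xD ?ij.
  by rewrite eq_sym xD ?ji.
have bumpN i : (i < N)%N -> (bump k i <= N)%N by rewrite /bump; case: (k <= i)%N; lia.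
rewrite -mulrA; congr (_ * _); rewrite /stair_ratio !altdet_Vandermonde.
have kN : (k <= N)%N by rewrite -ltnS.
(* The sign from the reordering is the same before and after lowering, so it cancels. *)
have exB (u : nat -> F) := @pairprod_extract _ (-1) _ k (fun i j => u i - u j) kN.
have exD (u : nat -> F) := @pairprod_extract _ 1 _ k (fun i j => u i + u j) kN.
rewrite !exB ?exD; try by move=> i j; ring.
have decrB i : decr x k (bump k i) = x (bump k i).
  by rewrite /decr eq_sym (negbTE (neq_bump _ _)) subr0.
rewrite (@eq_pairprod _ _ (fun i j => decr x k (bump k i) - decr x k (bump k j))
  (fun i j => x (bump k i) - x (bump k j))); last by move=> *; rewrite !decrB.
rewrite (@eq_pairprod _ _ (fun i j => decr x k (bump k i) + decr x k (bump k j))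
  (fun i j => x (bump k i) + x (bump k j))); last by move=> *; rewrite !decrB.
have bigdecr (h : F -> F -> F) :
  \prod_(i < N) h (decr x k k) (decr x k (bump k i)) =
  \prod_(i < N) h (x k - 1) (x (bump k i)).
  by apply: eq_bigr => i _; rewrite decrB /decr eqxx.
rewrite (bigdecr +%R) (bigdecr (fun u v => u - v)) prodf_div !big_split /=.
rewrite expr1n.
have nz1 : \prod_(i < N) (x k - x (bump k i)) != 0.
  by apply/prodf_neq0 => i _; rewrite subr_eq0 neqx ?bumpN ?neq_bump.
have nz2 : \prod_(i < N) (x k + x (bump k i)) != 0.
  apply/prodf_neq0 => i _; apply: lt0r_neq0.
  by have := x1 _ (ltn_ord k); have := x1 _ (bumpN _ (ltn_ord i)); lra.
have nz3 : \prod_(i < N) (x k - 1 + x (bump k i)) != 0.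
  apply/prodf_neq0 => i _; apply: lt0r_neq0.
  by have := x1 _ (ltn_ord k); have := x1 _ (bumpN _ (ltn_ord i)); lra.
have nz4 : pairprod N (fun i j => x (bump k i) + x (bump k j)) != 0.
  apply: pairprod_neq0 => i j /andP[ji iN]; apply: lt0r_neq0.
  have := x1 _ (bumpN _ iN); have := x1 _ (bumpN _ (ltn_trans ji iN)); lra.
by field; rewrite nz1 nz2 nz3 nz4.
Qed.

(** * Falling factorials and the eigenvalue equation *)

Definition falling (R : comPzRingType) (a : nat) (z : R) : R :=
  \prod_(i < a) (z - i%:R).

(** Both sides equal [falling a.+1 z]. *)
Lemma falling_decr (R : comPzRingType) a (z : R) :
  z * falling a (z - 1) = (z - a%:R) * falling a z.
Proof.
have -> : z * falling a (z - 1) = falling a.+1 z.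
  rewrite /falling big_ord_recl /= subr0; congr (_ * _).
  by apply: eq_bigr => i _; rewrite /bump /= add1n -natr1; ring.
by rewrite /falling big_ord_recr mulrC.
Qed.

Lemma fallingS_coef (R : comNzRingType) a (z : R) :
  falling a.+1 z = \sum_(p < a.+1) (rootpoly a (fun i => i.+1%:R))`_p * z ^+ p.+1.
Proof.
rewrite /falling big_ord_recl /= subr0.
transitivity (z * (rootpoly a (fun i => i.+1%:R)).[z]).
  by rewrite horner_rootpoly.
rewrite horner_coef size_rootpoly mulr_sumr; apply: eq_bigr => i _.
by rewrite exprS; ring.
Qed.

(** By [stair_ratio_rec] the powers [x_j ^+ p.+1] with [p < a] contribute 0, so [x_j ^+ a.+1] may be
    replaced by any monic polynomial of degree [a + 1] without constant term; the falling factorial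
    is the one that behaves well under lowering by 1. *)
Lemma stair_ratio_falling (F : numFieldType) n a (x : nat -> F) :
    (forall i j, (i < j <= n + a)%N -> x i + x j != 0) ->
  stair_ratio n (n + a).+1 x =
  \sum_(j < (n + a).+1) (-1) ^+ (n + a + j) * falling a.+1 (x j)
     * stair_ratio n (n + a) (fun i => x (bump j i)).
Proof.
move=> x0.
transitivity (\sum_(p < a.+1) (rootpoly a (fun i => i.+1%:R))`_p
   * (stair_ratio n (n + a).+1 x *+ (p == a :> nat))).
  rewrite big_ord_recr /= big1 ?add0r ?eqxx ?rootpoly_lead ?mul1r // => i _.
  by rewrite ltn_eqF // mulr0n mulr0.
transitivity (\sum_(p < a.+1) \sum_(j < (n + a).+1)
    (rootpoly a (fun i => i.+1%:R))`_p * ((-1) ^+ (n + a + j) * x j ^+ p.+1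
     * stair_ratio n (n + a) (fun i => x (bump j i)))).
  apply: eq_bigr => p _; have pa : (p <= a)%N by rewrite -ltnS.
  by rewrite -(stair_ratio_rec pa x0) big_distrr.
rewrite exchange_big; apply: eq_bigr => j _ /=; rewrite fallingS_coef.
move: (stair_ratio _ _ _) => w.
by rewrite mulr_sumr mulr_suml; apply: eq_bigr => p _; ring.
Qed.

(** Expand [W] on both sides by [stair_ratio_falling] and compare the summands for each [j].
    Lowering [x_j] gives the factor [x_j - (a + 1)] by [falling_decr], lowering the other variables
    gives the eigenvalue for [a], and ['C(a.+1, 2) + a.+1 = 'C(a.+2, 2)]. *)
Lemma stair_ratio_decr (F : realFieldType) n a (x : nat -> F) :
    (forall i, (i < n + a)%N -> 1 <= x i) ->
    (forall i j, (i < j < n + a)%N -> x i != x j) ->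
  \sum_(k < n + a) x k * stair_ratio n (n + a) (decr x k) =
  (\sum_(i < n + a) x i - 'C(a.+1, 2)%:R) * stair_ratio n (n + a) x.
Proof.
elim: a x => [|a IHa] x; first by rewrite addn0 subr0; exact: stair_ratio_decr0.
rewrite addnS => x1 xD.
have bumpN k i : (i < n + a)%N -> (bump k i < (n + a).+1)%N.
  by rewrite /bump; case: (k <= i)%N; lia.
have sum_neq0 (u v : F) : 1 <= u -> 0 <= v -> u + v != 0 /\ v + u != 0.
  by move=> ? ?; split; apply: lt0r_neq0; lra.
have recx : stair_ratio n (n + a).+1 x = _ :=
  @stair_ratio_falling F n a x _.
rewrite recx; last first.
  move=> i j /andP[ij jN]; apply: (sum_neq0 _ _ _ _).1; rewrite ?x1 ?ltnS //.
    by lia.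
  by rewrite (le_trans ler01) ?x1.
have IH (j : 'I_(n + a).+1) := IHa (fun i => x (bump j i))
  (fun i iN => x1 _ (bumpN _ _ iN)).
have {}IH (j : 'I_(n + a).+1) : \sum_(k < n + a) x (bump j k)
     * stair_ratio n (n + a) (decr (fun i => x (bump j i)) k) =
  (\sum_(k < n + a) x (bump j k) - 'C(a.+1, 2)%:R)
     * stair_ratio n (n + a) (fun i => x (bump j i)).
  apply: IH => i k /andP[ik kN]; apply: xD.
  by move: ik kN; rewrite /bump; case: (leqP j i); case: (leqP j k); lia.
transitivity (\sum_(k < (n + a).+1) \sum_(j < (n + a).+1)
   (-1) ^+ (n + a + j) * (x k * (falling a.+1 (decr x k j)
     * stair_ratio n (n + a) (fun i => decr x k (bump j i))))).
  apply: eq_bigr => k _; rewrite stair_ratio_falling ?mulr_sumr.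
    by apply: eq_bigr => j _; ring.
  (* At most one of two variables is lowered, so their sum stays positive. *)
  have ge1 i : (i <= n + a)%N -> 1 <= x i by move=> iN; rewrite x1 ?ltnS.
  move=> i j /andP[ij jN]; have iN := leq_trans (ltnW ij) jN.
  rewrite /decr; case: (altP (i =P k :> nat)) => [ik|_].
    rewrite -ik gtn_eqF // subr0; apply: (sum_neq0 _ _ _ _).2; rewrite ?ge1 //.
    by rewrite subr_ge0 ge1.
  rewrite subr0; apply: (sum_neq0 _ _ _ _).1; rewrite ?ge1 //.
  by have := ge1 _ jN; case: eqP => _; rewrite /= ?mulr1n ?mulr0n; lra.
rewrite exchange_big mulr_sumr; apply: eq_bigr => j _ /=.
rewrite -mulr_sumr -!mulrA mulrCA; congr (_ * _).
have jN : (j <= n + a)%N by rewrite -ltnS.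
(* Separate the summand [k = j], in which the lowered variable is the one missing from the ratio. *)
rewrite (sum_bump (fun k => x k * (falling a.+1 (decr x k j)
     * stair_ratio n (n + a) (fun i => decr x k (bump j i)))) jN).
rewrite (sum_bump x jN).
have -> : stair_ratio n (n + a) (fun i => decr x j (bump j i)) =
  stair_ratio n (n + a) (fun i => x (bump j i)).
  apply: eq_stair_ratio => i _.
  by rewrite /decr eq_sym (negbTE (neq_bump _ _)) subr0.
have -> : decr x j j = x j - 1 by rewrite /decr eqxx.
rewrite [x j * (_ * _)]mulrA falling_decr.
rewrite (eq_bigr (fun k : 'I_(n + a) => falling a.+1 (x j) * (x (bump j k)
   * stair_ratio n (n + a) (decr (fun i => x (bump j i)) k)))); last first.
  move=> k _; rewrite /decr (negbTE (neq_bump _ _)) subr0 mulrCA.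
  congr (_ * (_ * _)); apply: eq_stair_ratio => i _.
  by rewrite (inj_eq (can_inj (bumpK j))).
rewrite -mulr_sumr IH (binS a.+1 1) bin1 natrD; ring.
Qed.

(** * Alternants with special arguments *)

Lemma det_scale_col (R : comPzRingType) N (x : 'I_N -> R) (A : 'M[R]_N) :
  \det (\matrix_(i, j) (x j * A i j)) = (\prod_j x j) * \det A.
Proof.
have -> : \matrix_(i, j) (x j * A i j) = A *m diag_mx (\row_j x j).
  by apply/matrixP => i j; rewrite mul_mx_diag !mxE mulrC.
by rewrite det_mulmx det_diag mulrC; congr (_ * _); apply: eq_bigr => j _; rewrite mxE.
Qed.

(** This kills the summands in which lowering a row would make two rows equally long. *)
Lemma altdet_eq_col (R : comPzRingType) n N (x : nat -> R) i j :
  (i < j < N)%N -> x i = x j -> altdet n N x = 0.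
Proof.
move=> /andP[ij jN] xij; rewrite /altdet -det_tr.
apply: (@determinant_alternate _ _ _ (Ordinal (ltn_trans ij jN)) (Ordinal jN)).
  by rewrite -val_eqE /= ltn_eqF.
by move=> k; rewrite !mxE /= xij.
Qed.

Lemma altdet0_col0 (R : comPzRingType) N (x : nat -> R) :
  x 0%N = 0 -> altdet 0 N.+1 x = 0.
Proof.
move=> x0; rewrite /altdet (expand_det_col _ 0) big1 // => i _.
by rewrite !mxE /= x0 /stair_exp subn0 addnS expr0n mul0r.
Qed.

(** The column of [x_0 = 0] is the first unit vector; without it, the exponents are one larger than
    those for [n]. *)
Lemma altdetS_col0 (R : comPzRingType) n N (x : nat -> R) : x 0%N = 0 ->
  altdet n.+1 N.+1 x = (\prod_(i < N) x i.+1) * altdet n N (fun i => x i.+1).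
Proof.
move=> x0; rewrite /altdet (expand_det_col _ 0) big_ord_recl big1 ?addr0 => [|i _].
  rewrite !mxE /= x0 /stair_exp subSS sub0n expr0 mul1r /cofactor expr0 mul1r.
  rewrite -det_scale_col; congr (\det _); apply/matrixP => i j; rewrite !mxE /=.
  by rewrite -exprS; congr (_ ^+ _); rewrite /bump; lia.
by rewrite !mxE /= x0 /stair_exp /bump add1n addSn expr0n mul0r.
Qed.

Lemma stair_ratioS_col0 (F : fieldType) n N (x : nat -> F) :
    x 0%N = 0 -> (forall i, (i < N)%N -> x i.+1 != 0) ->
  stair_ratio n.+1 N.+1 x = stair_ratio n N (fun i => x i.+1).
Proof.
move=> x0 xP; rewrite /stair_ratio altdetS_col0 //.
rewrite (@pairprod_extract _ 1 _ 0) // => [|i j]; last by ring.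
rewrite expr1n mul1r.
have -> : \prod_(i < N) (x 0%N + x (bump 0 i)) = \prod_(i < N) x i.+1.
  by apply: eq_bigr => i _; rewrite x0 add0r /bump leq0n add1n.
have P0 : \prod_(i < N) x i.+1 != 0 by apply/prodf_neq0 => i _; apply: xP.
by rewrite invfM mulrACA mulfV // mul1r.
Qed.

(** The exponents are [1, 3, 5, ...], so this is the product of the variables times a Vandermonde
    determinant in their squares. *)
Lemma altdet0 (R : comPzRingType) N (x : nat -> R) :
  altdet 0 N x = (\prod_(i < N) x i) * pairprod N (fun i j => x i - x j)
                 * pairprod N (fun i j => x i + x j).
Proof.
rewrite -mulrA -pairprodM.
rewrite -(@eq_pairprod _ _ (fun i j => x i ^+ 2 - x j ^+ 2)) => [|i j _]; last by ring.
rewrite -(altdet_Vandermonde N (fun i => x i ^+ 2)) /altdet -det_scale_col.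
congr (\det _); apply/matrixP => i j; rewrite !mxE -exprM -exprS.
by congr (_ ^+ _); rewrite /stair_exp; have := ltn_ord i; lia.
Qed.

(** * Centered differences and alternants of arithmetic progressions *)

Lemma sum_common_support (V : nmodType) (T : eqType) (r s : seq T) (f : T -> V) :
    uniq r -> uniq s ->
    (forall i, i \in r -> i \notin s -> f i = 0) ->
    (forall i, i \in s -> i \notin r -> f i = 0) ->
  \sum_(i <- r) f i = \sum_(i <- s) f i.
Proof.
move=> ur us rs sr.
rewrite (bigID (mem s)) /= [X in _ + X]big_seq_cond [X in _ + X]big1 ?addr0.
  rewrite [RHS](bigID (mem r)) /= [X in _ = _ + X]big_seq_cond.
  rewrite [X in _ = _ + X]big1 ?addr0.
    rewrite -[LHS]big_filter -[RHS]big_filter; apply: perm_big; apply: uniq_perm.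
    - exact: filter_uniq.
    - exact: filter_uniq.
    - by move=> i; rewrite !mem_filter andbC.
  by move=> i /andP[]; apply: sr.
by move=> i /andP[]; apply: rs.
Qed.

Lemma stair_exp_mono n : {mono stair_exp n : i j / (i <= j)%N}.
Proof. by move=> i j; rewrite /stair_exp; apply/idP/idP; lia. Qed.

Lemma stair_exp_inj n : injective (stair_exp n).
Proof. exact: incn_inj (stair_exp_mono n). Qed.

(* The coefficient of [y ^+ s] in [(y + h) ^+ e - (y - h) ^+ e]. *)
Definition diff_coef (R : comPzRingType) (h : R) (e s : nat) : R :=
  (h ^+ (e - s) - (- h) ^+ (e - s)) *+ 'C(e, s).

Lemma diff_coef_eq0 (R : comPzRingType) (h : R) e s :
  ~~ odd (e - s) -> diff_coef h e s = 0.
Proof.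
move=> es; rewrite /diff_coef exprNn -signr_odd (negbTE es).
by rewrite mul1r subrr mul0rn.
Qed.

Lemma diff_coef_gt (R : comPzRingType) (h : R) e s :
  (e <= s)%N -> diff_coef h e s = 0.
Proof. by rewrite -subn_eq0 => /eqP es; rewrite diff_coef_eq0 // es. Qed.

Lemma diff_coefE (R : comPzRingType) (h y : R) e :
  (y + h) ^+ e - (y - h) ^+ e = \sum_(s < e.+1) diff_coef h e s * y ^+ s.
Proof.
rewrite [y + h]addrC [y - h]addrC !exprDn -sumrB.
apply: eq_bigr => s _; rewrite /diff_coef mulrnAl -mulrnBl.
by congr (_ *+ _); ring.
Qed.

(* Centered differences only produce exponents of the staircase for [n], since
   they change the parity. *)
Lemma stair_diff (R : comPzRingType) (h y : R) n N i : (i < N)%N ->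
  let e := stair_exp n.+1 i.+1 in
  (y + h) ^+ e - (y - h) ^+ e =
  \sum_(k < N) diff_coef h e (stair_exp n k) * y ^+ stair_exp n k.
Proof.
move=> iN e; rewrite diff_coefE.
have eE : e = (stair_exp n i).+1 by rewrite /e /stair_exp; lia.
rewrite -(big_mkord xpredT (fun s => diff_coef h e s * y ^+ s)).
rewrite -(big_mkord xpredT
  (fun k => diff_coef h e (stair_exp n k) * y ^+ stair_exp n k)).
rewrite -(big_map (stair_exp n) xpredT (fun s => diff_coef h e s * y ^+ s)).
apply: sum_common_support.
- exact: iota_uniq.
- by rewrite map_inj_uniq ?iota_uniq //; exact: stair_exp_inj.
- move=> s; rewrite mem_index_iota /= ltnS => se snot.
  rewrite diff_coef_eq0 ?mul0r //; apply: contra snot => odd_es.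
  have [k kE ki] : exists2 k, stair_exp n k = s & (k <= i)%N.
    have s_le : (s <= stair_exp n i)%N.
      by move: odd_es; rewrite eE; case: (ltngtP s (stair_exp n i).+1) => //; lia.
    (* For [i < n] all exponents up to [i] are present; otherwise [s] has the parity of [n + 1]. *)
    case: (ltnP i n) => iN'.
      by exists s; move: s_le; rewrite /stair_exp; lia.
    have [|k kE k2] := @stair_exp_parity n s.
      move: odd_es; rewrite eE /stair_exp => odd_es; move: s_le.
      by rewrite /stair_exp; lia.
    by exists k => //; move: k2 s_le; rewrite /stair_exp; lia.
  apply/mapP; exists k => //; rewrite mem_index_iota /=; lia.
- move=> s _; rewrite mem_index_iota /= -leqNgt => es.
  by rewrite diff_coef_gt ?mul0r // ltnW.
Qed.

Definition progression (R : pzRingType) (c m : R) (i : nat) : R := c + m * i%:R.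

(** Subtract from every column its left neighbour. The row of exponent 0 becomes [(1, 0, ..., 0)],
    and the other entries become centered differences at the midpoints [y_j]. By [stair_diff] what
    remains is a triangular matrix times the matrix of the alternant in the [y_j]. *)
Lemma altdet_progressionS (F : numFieldType) n N (c m : F) :
  altdet n.+1 N.+1 (progression c m) =
  (\prod_(i < N) (m *+ stair_exp n.+1 i.+1))
  * altdet n N (progression (c + m / 2) m).
Proof.
pose x := progression c m; pose y := progression (c + m / 2) m.
pose A : 'M[F]_N.+1 := \matrix_(i, j) x j ^+ stair_exp n.+1 i.
(* Right multiplication by the unitriangular [U] performs the column operations. *)
pose U : 'M[F]_N.+1 := \matrix_(i, j) ((i == j)%:R - (i.+1 == j)%:R).
have detU : \det U = 1.
  rewrite -det_tr det_trig.
    rewrite big1 // => i _; rewrite !mxE eqxx.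
    by rewrite eqn_leq ltnn subr0.
  apply/is_trig_mxP => i j ij; rewrite !mxE -val_eqE /=.
  by rewrite !gtn_eqF ?subr0 // ltnW.
have AU0 i : (A *m U) i 0 = x 0%N ^+ stair_exp n.+1 i.
  rewrite !mxE (bigD1 0) //= big1 => [|j j0].
    by rewrite !mxE /= subr0 mulr1 addr0.
  by rewrite !mxE (negbTE j0) /= subr0 mulr0.
have AUS i (j : 'I_N) : (A *m U) i (lift ord0 j) =
    x j.+1 ^+ stair_exp n.+1 i - x j ^+ stair_exp n.+1 i.
  rewrite !mxE (bigD1 (lift ord0 j)) //= (bigD1 (widen_ord (leqnSn N) j)); last first.
    by rewrite -val_eqE /= /bump leq0n add1n neq_ltn ltnSn.
  rewrite big1 => [|k /andP[k1 k2]] /=.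
    rewrite !mxE /= eqxx -val_eqE /= /bump leq0n add1n eqxx.
    rewrite [(_.+2 == _)%N]gtn_eqF // [(j == j.+1 :> nat)%N]ltn_eqF //.
    by rewrite /= ?mulr0n ?mulr1n; ring.
  rewrite !mxE (negbTE k1) /= /bump leq0n add1n eqSS.
  move: k2; rewrite -val_eqE /= => /negbTE->.
  by rewrite subr0 mulr0.
transitivity (\det (A *m U)); first by rewrite det_mulmx detU mulr1.
rewrite (expand_det_row _ 0) big_ord_recl big1 ?addr0; last first.
  by move=> j _; rewrite AUS /stair_exp subSS sub0n !expr0 subrr mul0r.
rewrite AU0 /stair_exp subSS sub0n expr0 mul1r /cofactor expr0 mul1r.
pose T : 'M[F]_N := \matrix_(i, k)
  diff_coef (m / 2) (stair_exp n.+1 i.+1) (stair_exp n k).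
have -> : row' 0 (col' 0 (A *m U)) =
    T *m (\matrix_(i < N, j < N) y j ^+ stair_exp n i).
  apply/matrixP => i j; rewrite !mxE.
  have := AUS (lift ord0 i) j; rewrite !mxE => ->.
  have -> : x j.+1 = y j + m / 2.
    by rewrite /x /y /progression -natr1; field.
  have -> : x j = y j - m / 2 by rewrite /x /y /progression; ring.
  rewrite /= /bump leq0n add1n (stair_diff _ _ _ (ltn_ord i)).
  by apply: eq_bigr => k _; rewrite !mxE.
rewrite det_mulmx; congr (_ * _); rewrite det_trig.
  apply: eq_bigr => i _; rewrite !mxE /diff_coef.
  have -> : stair_exp n.+1 i.+1 = (stair_exp n i).+1 by rewrite /stair_exp; lia.
  rewrite subSn // subnn !expr1 opprK binSn; congr (_ *+ _).
  by field.
apply/is_trig_mxP => i j ij; rewrite mxE diff_coef_gt //.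
have -> : stair_exp n.+1 i.+1 = (stair_exp n i).+1 by rewrite /stair_exp; lia.
by rewrite (leqW_mono (stair_exp_mono n)).
Qed.

(** After [n] difference steps, each of which moves the progression by [m / 2], only the odd
    exponents [1, 3, ..., 2a-1] are left. *)
Lemma altdet_progression (F : numFieldType) n a (c m : F) :
  altdet n (n + a) (progression c m) =
  (\prod_(t < n) \prod_(i < t + a) (m *+ stair_exp t.+1 i.+1))
  * altdet 0 a (progression (c + m *+ n / 2) m).
Proof.
elim: n c => [|n IHn] c; first by rewrite big_ord0 mul1r mulr0n mul0r addr0.
rewrite addSn altdet_progressionS IHn big_ord_recr /= mulrA.
congr (_ * _); first by rewrite mulrC.
by congr (altdet _ _ (progression _ _)); rewrite mulrSr; field.
Qed.

(** * Identities for [Phi] and [gimel] *)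

Lemma PhiS k : Phi k.+1 = (Phi k * k`!)%N.
Proof. by rewrite /Phi; case: k => [|k]; [rewrite !big_geq | rewrite big_nat_recr]. Qed.

Lemma gimelSS k : gimel k.+2 = (gimel k * k`!)%N.
Proof.
rewrite /gimel /= big_nat_recl //= mulnC; congr (_ * _)%N; last first.
  by rewrite muln1 subSS subn1.
by apply: eq_bigr => i _; rewrite mulnS -addn2 addnC subnDl.
Qed.

(** From [a] to [a + 1] both sides gain the factor [(n + 2a + 2)(n + 2a + 1)(n + 2a)!]. *)
Lemma gimel_ratioS n a :
  ((n + 2 * a)`! * gimel n.+1 * gimel (n + 2 * a) =
   n`! * (\prod_(i < a) (n + 2 + 2 * i)) * gimel n * gimel (n + 2 * a).+1)%N.
Proof.
elim: a => [|a IHa]; first by rewrite muln0 addn0 big_ord0; ring.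
have -> : (n + 2 * a.+1 = (n + 2 * a).+2)%N by ring.
rewrite !gimelSS big_ord_recr /= !factS.
have -> : ((n + 2 * a).+2 * ((n + 2 * a).+1 * (n + 2 * a)`!) * gimel n.+1
    * (gimel (n + 2 * a) * (n + 2 * a)`!) = (n + 2 * a).+2 * ((n + 2 * a).+1
    * (n + 2 * a)`!) * ((n + 2 * a)`! * gimel n.+1 * gimel (n + 2 * a)))%N.
  by ring.
by rewrite IHa; ring.
Qed.

(** This expresses the double product left by the difference steps in the terms of the final
    formula. Multiplying by positive values of [gimel] lets [gimel_ratioS] carry out the induction
    step. *)
Lemma Phi_gimel n a :
  (Phi (n + 2 * a) * gimel (2 * a) * gimel n =
   Phi (2 * a) * gimel (n + 2 * a) * Phi n
   * \prod_(t < n) \prod_(i < a) (t + 2 + 2 * i))%N.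
Proof.
have gimel_gt0 k : (0 < gimel k)%N by apply: prodn_gt0 => i; exact: fact_gt0.
elim: n => [|n IHn].
  rewrite !add0n big_ord0.
  have [-> ->] : gimel 0 = 1%N /\ Phi 0 = 1%N by rewrite /gimel /Phi !big_geq.
  by rewrite !muln1.
rewrite addSn !PhiS big_ord_recr /=.
apply/eqP; rewrite -(eqn_pmul2l (gimel_gt0 (n + 2 * a)%N)).
rewrite -(eqn_pmul2l (gimel_gt0 n)); apply/eqP.
transitivity ((Phi (n + 2 * a) * gimel (2 * a) * gimel n)
  * ((n + 2 * a)`! * gimel n.+1 * gimel (n + 2 * a)))%N; first by ring.
by rewrite IHn gimel_ratioS; ring.
Qed.

(** * The alternant of a progression in product form *)

Lemma pairprod_progression (R : comNzRingType) N (c m : R) :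
  pairprod N (fun i j => progression c m i - progression c m j) =
  m ^+ 'C(N, 2) * (Phi N)%:R.
Proof.
elim: N => [|N IHN]; first by rewrite /pairprod /Phi big_ord0 big_geq // mul1r.
rewrite pairprodS IHN PhiS (binS N 1) bin1 exprD natrM.
suff -> : \prod_(j < N) (progression c m N - progression c m j) =
    m ^+ N * N`!%:R by ring.
transitivity (\prod_(j < N) (m * (N - j)%:R)).
  apply: eq_bigr => j _; rewrite natrB ?(ltnW (ltn_ord _)) // /progression.
  by ring.
rewrite big_split prodr_const card_ord /= fact_prod big_add1 /= big_mkord.
rewrite natr_prod; congr (_ * _); rewrite (reindex_inj rev_ord_inj) /=.
by apply: eq_bigr => j _; rewrite subKn.
Qed.

(** The exponents are [1, ..., t], followed by [t + 2, t + 4, ..., t + 2a]. *)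
Lemma prod_stair_exp (R : comPzRingType) t a (m : R) :
  \prod_(i < t + a) (m *+ stair_exp t.+1 i.+1) =
  m ^+ (t + a) * (t`! * \prod_(i < a) (t + 2 + 2 * i))%:R.
Proof.
under eq_bigr => i _ do rewrite -mulr_natr.
rewrite big_split prodr_const card_ord /=; congr (_ * _).
rewrite -natr_prod big_split_ord /=; congr ((_ * _)%:R).
  rewrite fact_prod big_add1 /= big_mkord; apply: eq_bigr => i _.
  by rewrite /stair_exp /=; have := ltn_ord i; lia.
by apply: eq_bigr => i _; rewrite /stair_exp /=; lia.
Qed.

(** The difference steps lead to the shifted progression [z], and [x_(n+i) + x_j = z_i + z_j]. So
    the pair sums of [altdet0] and its factors [z_i], doubled for [j = i], make up the product over
    [j <= i]; hence the [2 ^+ a]. *)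
Lemma altdet_progression_pairs (F : numFieldType) n a (c m : F) :
  let x := progression c m in
  altdet n (n + a) x * (Phi (n + a))%:R =
  pairprod (n + a) (fun i j => x i - x j)
  * (Phi n * Phi a * \prod_(t < n) \prod_(i < a) (t + 2 + 2 * i))%:R
  / 2 ^+ a * \prod_(i < a) \prod_(j < i.+1) (x (n + i)%N + x j).
Proof.
move=> x; pose z := progression (c + m *+ n / 2) m.
have xz i j : x (n + i)%N + x j = z i + z j.
  by rewrite /x /z /progression natrD -mulr_natr; field.
have -> : \prod_(i < a) \prod_(j < i.+1) (x (n + i)%N + x j) =
    2 ^+ a * (\prod_(i < a) z i) * pairprod a (fun i j => z i + z j).
  have -> : (2 : F) ^+ a = \prod_(i < a) 2 by rewrite prodr_const card_ord.
  rewrite -!big_split /=; apply: eq_bigr => i _.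
  rewrite big_ord_recr /= mulrC xz; congr (_ * _); first by ring.
  by apply: eq_bigr => j _; rewrite xz.
rewrite altdet_progression altdet0 !pairprod_progression.
(* The powers of [m] from the difference steps and from the [z_i - z_j] combine to the one in the
   product of the [x_i - x_j]. *)
have -> : m ^+ 'C(n + a, 2) = (\prod_(t < n) m ^+ (t + a)) * m ^+ 'C(a, 2).
  elim: (n) => [|k IHk]; first by rewrite big_ord0 mul1r.
  by rewrite big_ord_recr /= addSn binS bin1 exprD IHk; ring.
rewrite (eq_bigr (fun t : 'I_n => m ^+ (t + a)
   * (t`! * \prod_(i < a) (t + 2 + 2 * i))%:R)); last first.
  by move=> t _; rewrite prod_stair_exp.
rewrite big_split /= -natr_prod big_split /=.
have -> : (\prod_(t < n) t`! = Phi n)%N.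
  elim: (n) => [|k IHk]; first by rewrite big_ord0 /Phi big_geq.
  by rewrite big_ord_recr PhiS IHk.
have p0 : (2 : F) ^+ a != 0 by rewrite expf_neq0 // pnatr_eq0.
rewrite !natrM -/z; field; exact: p0.
Qed.

(** * Standard tableaux and removal of the largest entry *)

Definition cell_lt (c d : nat * nat) : bool :=
  (c.1 == d.1) && (c.2 < d.2)%N || (c.2 == d.2) && (c.1 < d.1)%N.

Definition corner (p : {fset nat * nat}) (c : nat * nat) : bool :=
  [forall d : p, ~~ cell_lt c (val d)].

Lemma cornerP (p : {fset nat * nat}) c :
  reflect (forall d, d \in p -> ~~ cell_lt c d) (corner p c).
Proof.
apply: (iffP forallP) => [pc d dp | pc d]; first exact: (pc [` dp]).
exact: pc (fsvalP d).
Qed.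

Lemma is_SYTP (p : {fset nat * nat}) (t : {ffun p -> 'I_(#|` p|)}) :
  reflect (injective t /\
           forall c d : p, cell_lt (val c) (val d) -> (t c < t d)%N)
          (is_SYT t).
Proof.
apply: (iffP and3P) => [[/injectiveP tI /forallP r /forallP k]|[tI tP]].
  split=> // c d /orP[]; first by have /forallP/(_ d)/implyP := r c.
  by have /forallP/(_ d)/implyP := k c.
split; first exact/injectiveP.
  apply/forallP => c; apply/forallP => d; apply/implyP => cd.
  by apply: tP; rewrite /cell_lt cd.
apply/forallP => c; apply/forallP => d; apply/implyP => cd.
by apply: tP; rewrite /cell_lt cd orbT.
Qed.

Lemma num_SYT_fset0 : num_SYT fset0 = 1%N.
Proof.
rewrite /num_SYT; have e0 (c : fset0 : {fset nat * nat}) : False.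
  by have := fsvalP c; rewrite inE.
have sz : #|` (fset0 : {fset nat * nat})| = 0%N by rewrite cardfs0.
apply/eqP/cards1P; exists [ffun c => False_rect _ (e0 c)].
apply/setP => t; rewrite !inE; apply/idP/eqP => [_|_].
  by apply/ffunP => c; case: (e0 c).
by apply/is_SYTP; split=> c; case: (e0 c).
Qed.

Section MaxEntry.

Variables (p : {fset nat * nat}) (c : p).

Let q := p `\ val c.

Let card_q : #|` p| = #|` q|.+1.
Proof. by rewrite /q (cardfsD1 (val c) p) fsvalP. Qed.

Let max_proof : (#|` q| < #|` p|)%N. Proof. by rewrite card_q. Qed.
Let max_entry := Ordinal max_proof.
Let q_le_p : (#|` q| <= #|` p|)%N. Proof. exact: ltnW. Qed.

Let entry_le (i : 'I_(#|` p|)) : (i <= #|` q|)%N.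
Proof. by rewrite -ltnS -card_q. Qed.

Let max_entryE (i : 'I_(#|` p|)) : (i == max_entry) = (i.+1 == #|` p|).
Proof. by rewrite -val_eqE /= -eqSS -card_q. Qed.

(** The type of the entries depends on the number of cells, so old entries are embedded by
    [widen_ord]; [c], the only cell outside [q], receives the new top value. *)
Definition extend_SYT (u : {ffun q -> 'I_(#|` q|)}) : {ffun p -> 'I_(#|` p|)} :=
  [ffun d : p => if insub (val d) : option q is Some d'
                 then widen_ord q_le_p (u d') else max_entry].

Lemma extend_SYT_in u (d : p) (d' : q) :
  val d = val d' -> extend_SYT u d = widen_ord q_le_p (u d').
Proof. by move=> dd'; rewrite ffunE dd' valK. Qed.

Lemma extend_SYT_max u : extend_SYT u c = max_entry.
Proof. by rewrite ffunE insubF // !inE eqxx. Qed.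

Lemma in_remove (d : p) : d != c -> exists d' : q, val d = val d'.
Proof.
move=> dc; have dq : val d \in q by rewrite !inE fsvalP andbT.
by exists [` dq].
Qed.

Lemma from_remove (d' : q) : exists2 d : p, d != c & val d = val d'.
Proof.
have := fsvalP d'; rewrite !inE => /andP[dc dp].
by exists [` dp].
Qed.

Lemma extend_SYT_inj : injective extend_SYT.
Proof.
move=> u v uv; apply/ffunP => d'; have [d _ dE] := from_remove d'.
have := congr1 (fun f : {ffun p -> 'I_(#|` p|)} => val (f d)) uv.
by rewrite !(extend_SYT_in _ dE) /= => /val_inj.
Qed.

(** [extend_SYT] is a bijection onto these tableaux: a top entry in a corner violates no inequality,
    and conversely the remaining entries restrict to a tableau of [q]. *)
Lemma card_SYT_max : corner p (val c) ->
  #|[set t : {ffun p -> 'I_(#|` p|)} | is_SYT t && ((t c).+1 == #|` p|)]| =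
  num_SYT q.
Proof.
move=> /cornerP cc; rewrite /num_SYT -(card_imset _ extend_SYT_inj).
congr #|pred_of_set _|; apply/setP => t; rewrite inE -max_entryE.
apply/andP/imsetP => [[/is_SYTP[tI tP] /eqP tc]|[u]]; last first.
  rewrite inE => /is_SYTP[uI uP] ->; rewrite extend_SYT_max eqxx; split => //.
  apply/is_SYTP; split=> [d e|d e de].
    have [->|/in_remove[d' dE]] := eqVneq d c.
      have [->|/in_remove[e' eE]] // := eqVneq e c.
      rewrite extend_SYT_max (extend_SYT_in _ eE) => /(congr1 val) /= E.
      by have := ltn_ord (u e'); rewrite -E ltnn.
    have [->|/in_remove[e' eE]] := eqVneq e c.
      rewrite extend_SYT_max (extend_SYT_in _ dE) => /(congr1 val) /= E.
      by have := ltn_ord (u d'); rewrite E ltnn.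
    rewrite (extend_SYT_in _ dE) (extend_SYT_in _ eE) => /(congr1 val) /=.
    by move/val_inj/uI => d'e'; apply: val_inj; rewrite dE eE d'e'.
  have dc : d != c.
    by apply: contraTneq de => ->; apply: cc; apply: fsvalP.
  have [d' dE] := in_remove dc.
  have [->|/in_remove[e' eE]] := eqVneq e c.
    by rewrite extend_SYT_max (extend_SYT_in _ dE) /=.
  rewrite (extend_SYT_in _ dE) (extend_SYT_in _ eE) /=; apply: uP.
  by rewrite -dE -eE.
have inP (d' : q) : val d' \in p by have := fsvalP d'; rewrite !inE => /andP[].
(* By injectivity only [c] carries the top value. *)
have lt_q (d' : q) : (t [` inP d'] < #|` q|)%N.
  have := entry_le (t [` inP d']); rewrite leq_eqVlt => /predU1P[E|] //.
  have /tI/(congr1 val)/= E' : t [` inP d'] = t c by apply: val_inj; rewrite tc.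
  by have := fsvalP d'; rewrite !inE => /andP[/eqP/(_ E')].
exists [ffun d' : q => Ordinal (lt_q d')].
  rewrite inE; apply/is_SYTP; split=> [d e|d e de]; rewrite !ffunE.
    by move=> /(congr1 val)/= /val_inj/tI/(congr1 val)/= /val_inj.
  by rewrite /=; apply: tP.
apply/ffunP => d; have [->|dc] := eqVneq d c; first by rewrite tc extend_SYT_max.
have [d' dE] := in_remove dc.
rewrite (extend_SYT_in _ dE) ffunE; apply: val_inj => /=.
by congr (nat_of_ord (t _)); apply: val_inj.
Qed.

Lemma card_SYT_max0 : ~~ corner p (val c) ->
  #|[set t : {ffun p -> 'I_(#|` p|)} | is_SYT t && ((t c).+1 == #|` p|)]| = 0%N.
Proof.
case/forallPn => d; rewrite negbK => cd; apply: eq_card0 => t; rewrite !inE -max_entryE.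
apply/negbTE/negP => /andP[/is_SYTP[tI /(_ c d cd) tP] /eqP tc].
by move: tP; rewrite tc /= ltnNge entry_le.
Qed.

End MaxEntry.

(* Sort the tableaux by the cell that holds the largest entry. *)
Lemma num_SYT_rec (p : {fset nat * nat}) : p != fset0 ->
  num_SYT p = \sum_(c <- p | corner p c) num_SYT (p `\ c).
Proof.
move=> p0; rewrite big_seq_fsetE /=.
have lt_p : (#|` p|.-1 < #|` p|)%N by rewrite prednK // cardfs_gt0.
pose top := Ordinal lt_p.
transitivity (\sum_(c : p)
  #|[set t : {ffun p -> 'I_(#|` p|)} | is_SYT t && ((t c).+1 == #|` p|)]|)%N.
  under eq_bigr => c _ do rewrite -sum1dep_card.
  rewrite (exchange_big_dep (@is_SYT p)) /=; last by move=> c t _ /andP[].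
  rewrite /num_SYT -sum1dep_card; apply: eq_bigr => t tS; have [tI _] := is_SYTP _ tS.
  (* A tableau is bijective, so it is counted once, for the cell [g top]. *)
  have [g tK gK] : bijective t.
    apply: inj_card_bij => //; by rewrite card_ord -cardfE.
  rewrite (bigD1 (g top)) /=; last first.
    by rewrite gK /= prednK ?cardfs_gt0 // eqxx andbT.
  rewrite big1 ?addn0 // => c /andP[/andP[_ /eqP cE]] /negP[].
  by apply/eqP; rewrite -(tK c); congr g; apply: val_inj; exact: (congr1 predn cE).
rewrite [RHS]big_mkcond; apply: eq_bigr => c _.
case: ifP => cc; first by rewrite card_SYT_max.
by rewrite card_SYT_max0 ?cc.
Qed.

(** * Shifted diagrams, with rows numbered from the bottom *)

Lemma mem_shifted_diagram nu i j :
  ((i, j) \in shifted_diagram nu) =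
  (0 < i <= size nu)%N && (i <= j < i + part nu i)%N.
Proof.
rewrite !inE; apply/allpairsPdep/andP => [[k [l [kn ln [-> ->]]]] | [iN ij]].
  by move: kn ln; rewrite !mem_iota add1n ltnS.
by exists i, j; rewrite !mem_iota add1n ltnS.
Qed.

Lemma uniq_shifted_cells nu :
  uniq [seq (i, j) | i <- iota 1 (size nu), j <- iota i (part nu i)].
Proof.
apply: allpairs_uniq_dep => [|i _|[i j] [k l] _ _ /= [-> ->] //];
exact: iota_uniq.
Qed.

Lemma prod_shifted_diagram (R : comPzRingType) nu (f : nat * nat -> R) :
  \prod_(c <- shifted_diagram nu) f c =
  \prod_(1 <= i < (size nu).+1) \prod_(i <= j < i + part nu i) f (i, j).
Proof.
rewrite (perm_big _ (_ : perm_eq (shifted_diagram nu)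
  [seq (i, j) | i <- iota 1 (size nu), j <- iota i (part nu i)])) /=; last first.
  apply: uniq_perm; rewrite ?fset_uniq ?uniq_shifted_cells // => c.
  by rewrite !inE.
rewrite big_allpairs_dep /index_iota subn1; apply: eq_bigr => i _.
by rewrite addKn.
Qed.

Lemma card_shifted_diagram nu : #|` shifted_diagram nu| = sumn nu.
Proof.
rewrite card_fseq undup_id ?uniq_shifted_cells // size_allpairs_dep.
congr sumn; apply: (@eq_from_nth _ 0%N); rewrite ?size_map ?size_iota // => i iN.
by rewrite (nth_map 0%N) ?size_iota // nth_iota // add1n.
Qed.

Lemma iota1E k : iota 1 k = index_iota 1 k.+1.
Proof. by rewrite /index_iota subn1. Qed.

Lemma sumn_delta k : sumn (delta k) = 'C(k, 2).
Proof.
rewrite -bin2_sum sumnE big_map iota1E.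
rewrite big_add1 big_nat_rev /= !big_nat; apply: eq_bigr => i /andP[_ ik].
by rewrite add0n subnS subKn.
Qed.

Lemma size_delta k : size (delta k) = k.
Proof. by rewrite size_map size_iota. Qed.

Lemma part_delta k i : (0 < i <= k)%N -> part (delta k) i = (k - i)%N.
Proof.
case: i => // i /andP[_ ik].
by rewrite /part (nth_map 0%N) ?size_iota //= nth_iota.
Qed.

Definition parts (N : nat) (y : nat -> nat) : seq nat :=
  [seq y (N - k)%N | k <- iota 1 N].

Lemma size_parts N y : size (parts N y) = N.
Proof. by rewrite size_map size_iota. Qed.

Lemma part_parts N y i : (0 < i <= N)%N -> part (parts N y) i = y (N - i)%N.
Proof.
case: i => // i /andP[_ iN].
by rewrite /part (nth_map 0%N) ?size_iota //= nth_iota.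
Qed.

Lemma sumn_parts N y : sumn (parts N y) = (\sum_(i < N) y i)%N.
Proof.
rewrite sumnE big_map iota1E.
rewrite big_add1 big_nat_rev /= -(big_mkord xpredT) !big_nat.
by apply: eq_bigr => i /andP[_ iN]; rewrite add0n subnS subKn.
Qed.

Definition stair_shape (N a : nat) (y : nat -> nat) : {fset nat * nat} :=
  shifted_skew (parts N y) (delta a.+1).

(** Each row [1, ..., a] of the removed diagram ends in column [a]. *)
Lemma mem_stair_shape N a y i j :
  ((i, j) \in stair_shape N a y) =
  (0 < i <= N)%N && (maxn i a.+1 <= j < i + y (N - i))%N.
Proof.
rewrite /stair_shape /shifted_skew in_fsetD !mem_shifted_diagram size_parts.
rewrite size_delta geq_max.
case iN: (0 < i <= N)%N; last by rewrite andbF.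
rewrite part_parts // andbC; case/andP: iN => i0 iN.
case ij: (i <= j)%N => //=; case: (j < _)%N; rewrite ?andbF //= andbT i0 /=.
case: (leqP i a.+1) => ia /=; last by symmetry; apply: leq_trans ij; apply: ltnW.
by rewrite part_delta ?i0 //; lia.
Qed.

Definition strict_pos (N : nat) (y : nat -> nat) : Prop :=
  (forall i, (i < N)%N -> (0 < y i)%N) /\
  (forall i, (i.+1 < N)%N -> (y i < y i.+1)%N).

Lemma strict_pos_gap N y i j : strict_pos N y -> (i <= j)%N -> (j < N)%N ->
  (y i + (j - i) <= y j)%N.
Proof.
move=> [_ yS]; elim: j => [|j IHj]; first by case: i => // _ _; rewrite subnn addn0.
rewrite leq_eqVlt => /predU1P[->|]; first by rewrite subnn addn0.
rewrite ltnS => ij jN; have := yS j jN; have := IHj ij (ltnW jN); lia.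
Qed.

Lemma strict_pos_ge N y j : strict_pos N y -> (j < N)%N -> (j < y j)%N.
Proof.
move=> yP jN; have := strict_pos_gap yP (leq0n j) jN.
have := yP.1 0%N (leq_ltn_trans (leq0n j) jN); lia.
Qed.

Lemma card_stair_shape N a y : strict_pos N y -> (a <= N)%N ->
  (#|` stair_shape N a y| + 'C(a.+1, 2) = \sum_(i < N) y i)%N.
Proof.
move=> yP aN; rewrite -sumn_parts -card_shifted_diagram -sumn_delta.
rewrite -card_shifted_diagram /stair_shape /shifted_skew.
suff sub : shifted_diagram (delta a.+1) `<=` shifted_diagram (parts N y).
  by rewrite cardfsDS // subnK // fsubset_leq_card.
apply/fsubsetP => -[i j]; rewrite !mem_shifted_diagram size_parts size_delta.
move=> /andP[ia ij]; have iN : (0 < i <= N)%N.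
  by move: ij; rewrite part_delta //; lia.
rewrite part_parts // iN; move: ij; rewrite part_delta //.
have := @strict_pos_ge N y (N - i) yP; lia.
Qed.

(** * Corners of the skew shape *)

Definition row_end (N : nat) (y : nat -> nat) (k : nat) : nat * nat :=
  ((N - k)%N, (N - k + y k).-1%N).

(** For positive row lengths, the bottom row fails the test only if [n = 0] and its length is 1; its
    single cell then lies in the removed diagram. For the other rows, the test says that the row
    below ends in an earlier column; the successor accounts for the shift of that row. *)
Definition removable (n : nat) (y : nat -> nat) (k : nat) : bool :=
  if k is k'.+1 then ((y k').+1 < y k)%N else (1 < n + y 0%N)%N.

Definition decrn (y : nat -> nat) (k i : nat) : nat := (y i - (i == k))%N.

Lemma mem_corners n a y c : strict_pos (n + a) y ->
  (c \in stair_shape (n + a) a y) && corner (stair_shape (n + a) a y) c =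
  (c \in [seq row_end (n + a) y k | k <- iota 0 (n + a) & removable n y k]).
Proof.
move NE : (n + a)%N => N yP; set p := stair_shape N a y.
apply/andP/mapP => [[cp /cornerP cc]|[k]]; last first.
  rewrite mem_filter mem_iota add0n => /andP[kr /andP[_ kN]] ->.
  have yk := strict_pos_ge yP kN.
  split.
    rewrite mem_stair_shape; case: k kr kN yk => [|k] /= kr kN yk.
      by rewrite !subn0 subnn; lia.
    by have := @strict_pos_ge _ y k yP; rewrite subKn; lia.
  apply/cornerP => -[i j]; rewrite mem_stair_shape => /andP[iN ij].
  rewrite /cell_lt /=; apply/negP => /orP[/andP[/eqP ik jk]|/andP[/eqP jk ik]].
    by move: ij; rewrite -ik subKn; lia.
  case: k kr kN yk ik jk => [|k] /= kr kN yk ik jk; first by lia.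
  have := @strict_pos_gap N y (N - i) k yP; lia.
case: c cp cc => i j; rewrite mem_stair_shape => /andP[iN ij] cc.
have jE : j = (i + y (N - i)).-1%N.
  have := cc (i, j.+1); rewrite mem_stair_shape iN /cell_lt /= eqxx ltnSn /=.
  by move: ij => /andP[ij1 ij2] H; apply/eqP; apply: contraT => jE;
    apply: H; lia.
exists (N - i)%N; last by rewrite /row_end subKn ?jE //; lia.
rewrite mem_filter mem_iota add0n; apply/andP; split; last by lia.
have Ni : (N - i < N)%N by lia.
have yi := strict_pos_ge yP Ni.
case E : (N - i)%N => [|k] /=; first by rewrite E in jE; lia.
(* The cell below a corner is outside the shape, which bounds the end of the next row. *)
have := cc (i.+1, j); rewrite mem_stair_shape /cell_lt /= eqxx ltnSn orbT.
have -> : (N - i.+1)%N = k by lia.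
rewrite E in jE ij yi => H; rewrite ltnNge; apply/negP => yk.
have yk0 := yP.1 k; have ykS := yP.2 k; apply: (negP (H _)) => //; lia.
Qed.

Lemma sum_corners n a y (G : nat * nat -> nat) : strict_pos (n + a) y ->
  (\sum_(c <- stair_shape (n + a) a y | corner (stair_shape (n + a) a y) c) G c =
   \sum_(k < n + a | removable n y k) G (row_end (n + a) y k))%N.
Proof.
move=> yP; rewrite -(big_mkord (removable n y) (fun k => G (row_end _ y k))).
rewrite -[RHS]big_filter -(big_map (row_end _ y) xpredT) -[LHS]big_filter.
apply: perm_big; apply: uniq_perm.
- by rewrite filter_uniq // fset_uniq.
- rewrite map_inj_in_uniq ?filter_uniq ?iota_uniq // => k l.
  rewrite !mem_filter !mem_iota /= => kN lN [E _]; lia.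
- by move=> c; rewrite mem_filter andbC mem_corners // /index_iota subn0.
Qed.

Lemma stair_shape_remove n a y k : strict_pos (n + a) y -> (k < n + a)%N ->
  stair_shape (n + a) a y `\ row_end (n + a) y k =
  stair_shape (n + a) a (decrn y k).
Proof.
move=> yP kN; have yk := yP.1 k kN; apply/fsetP => -[i j].
rewrite in_fsetD1 !mem_stair_shape /decrn /row_end xpair_eqE.
case iN: (0 < i <= n + a)%N; last by rewrite andbF.
case: (eqVneq (n + a - i)%N k) => [E|E].
  by rewrite -E subKn; lia.
have -> : (i == n + a - k)%N = false by lia.
by rewrite subn0.
Qed.

Lemma strict_pos_decrn n N y k : strict_pos N y -> (k < N)%N ->
    removable n y k -> (1 < y k)%N -> strict_pos N (decrn y k).
Proof.
move=> [yP yS] kN kr yk; split=> i iN; rewrite /decrn.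
  by have := yP i iN; case: eqP => [->|]; lia.
have := yS i iN; have := yP i; case: eqP => [ik|]; case: eqP => [iSk|]; try lia.
by move: kr; rewrite -iSk /=; lia.
Qed.

Lemma stair_shape_col0 N a y : y 0%N = 0%N ->
  stair_shape N.+1 a y = stair_shape N a (fun i => y i.+1).
Proof.
move=> y0; apply/fsetP => -[i j]; rewrite !mem_stair_shape.
case: (leqP i N) => iN; first by rewrite subSn // (leqW iN).
rewrite andbF; case: (leqP i N.+1) => iN1; last by rewrite andbF.
have -> : i = N.+1 by lia.
by rewrite subnn y0 addn0; lia.
Qed.

(** * The number of tableaux for arbitrary strict partitions *)

(** These are the row lengths of the removed diagram itself, for which the skew shape is empty. *)
Lemma stair_ratio_small a :
  stair_ratio 0 a (fun i => i.+1%:R) = (\prod_(i < a) (i.+1)`!%:R) :> rat.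
Proof.
rewrite /stair_ratio altdet0 mulfK; last first.
  by apply: pairprod_neq0 => i j _; rewrite -natrD pnatr_eq0.
rewrite (@eq_pairprod _ _ _ (fun i j => progression 1 1 i - progression 1 1 j)).
  rewrite pairprod_progression expr1n mul1r.
  elim: a => [|a IHa]; first by rewrite !big_ord0 /Phi big_geq // mul1r.
  by rewrite !big_ord_recr /= -IHa PhiS factS !natrM; ring.
by move=> i j _; rewrite /progression -!natr1; ring.
Qed.

(** Induction on the number of cells, removing the largest entry. Rows that are not removable may be
    included in the sum, as their summands vanish; the eigenvalue equation then evaluates it. *)
Lemma num_SYT_stair n a y : strict_pos (n + a) y ->
  (num_SYT (stair_shape (n + a) a y))%:R =
  (#|` stair_shape (n + a) a y|)`!%:R / \prod_(i < n + a) (y i)`!%:R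
  * stair_ratio n (n + a) (fun i => (y i)%:R) :> rat.
Proof.
move Es : #|` stair_shape (n + a) a y| => s; elim: s n y Es => [|s IHs] n y Es yP.
  have p0 : stair_shape (n + a) a y = fset0 by apply: cardfs0_eq.
  (* The first row is empty, so its length is at most [a], but it is at least [n + a]: hence [n = 0]
     and all rows have their least length. *)
  have yE i : (i < n + a)%N -> y i = i.+1 /\ n = 0%N.
    move=> iN; have NN : ((n + a).-1 < n + a)%N by lia.
    have : (1%N, y (n + a).-1) \notin stair_shape (n + a) a y by rewrite p0 inE.
    rewrite mem_stair_shape subn1.
    have := strict_pos_ge yP NN; have := strict_pos_ge yP iN.
    by have := @strict_pos_gap _ y i (n + a).-1 yP; lia.
  rewrite p0 num_SYT_fset0 fact0.
  case: (posnP (n + a)) => [N0|Npos].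
    by rewrite N0 big_ord0 /stair_ratio /altdet /pairprod det_mx00 big_ord0 !divr1.
  have n0 := (yE 0%N Npos).2; rewrite n0 add0n in yE *.
  rewrite (@eq_stair_ratio _ _ _ _ (fun i => i.+1%:R)); last first.
    by move=> i /yE[->].
  rewrite stair_ratio_small (eq_bigr (fun i : 'I_a => (i.+1)`!%:R)); last first.
    by move=> i _; rewrite (yE i (ltn_ord i)).1.
  by rewrite mul1r mulVf //; apply/prodf_neq0 => i _; rewrite pnatr_eq0 -lt0n fact_gt0.
have pn0 : stair_shape (n + a) a y != fset0 by rewrite -cardfs_gt0 Es.
rewrite num_SYT_rec // sum_corners // natr_sum.
pose x i : rat := (y i)%:R; set P := \prod_(i < n + a) _.
have x1 i : (i < n + a)%N -> 1 <= x i by move=> /(yP.1); rewrite ler1n.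
have xD i j : (i < j < n + a)%N -> x i != x j.
  move=> /andP[ij jN]; rewrite eqr_nat neq_ltn.
  by have := strict_pos_gap yP (ltnW ij) jN; lia.
have xdecr k i : (k < n + a)%N -> (decrn y k i)%:R = decr x k i.
  move=> /(yP.1) yk; rewrite /decrn /decr; case: eqP => [->|_].
    by rewrite natrB.
  by rewrite subn0 subr0.
have fact_decr k : (k < n + a)%N ->
    P = x k * \prod_(i < n + a) (decrn y k i)`!%:R.
  move=> kN; rewrite /P (bigD1 (Ordinal kN)) //= [in RHS](bigD1 (Ordinal kN)) //=.
  rewrite mulrA; congr (_ * _).
    rewrite /decrn eqxx subn1; have := yP.1 k kN.
    by rewrite /x; case: (y k) => // yk _; rewrite factS natrM.
  apply: eq_bigr => i; rewrite -val_eqE /= => ik.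
  by rewrite /decrn (negbTE ik) subn0.
have P0 : P != 0 by apply/prodf_neq0 => i _; rewrite pnatr_eq0 -lt0n fact_gt0.
(* The eigenvalue is the number of cells. *)
have cardp : s.+1%:R = \sum_(i < n + a) x i - 'C(a.+1, 2)%:R :> rat.
  have := card_stair_shape yP (leq_addl n a); rewrite Es => E.
  by rewrite -natr_sum -E natrD addrK.
rewrite factS natrM mulrC.
transitivity (s`!%:R / P * (s.+1%:R * stair_ratio n (n + a) x)); last by ring.
rewrite cardp -stair_ratio_decr // mulr_sumr big_mkcond; apply: eq_bigr => k _.
have kN := ltn_ord k; have yk := yP.1 k kN.
have ratioE : stair_ratio n (n + a) (decr x k) =
    stair_ratio n (n + a) (fun i => (decrn y k i)%:R).
  by apply: eq_stair_ratio => i _; rewrite xdecr.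
have xk0 : x k != 0 by rewrite pnatr_eq0 -lt0n.
have D0 : \prod_(i < n + a) (decrn y k i)`!%:R != 0 :> rat.
  by move: P0; rewrite (fact_decr k kN) mulf_eq0 negb_or => /andP[].
case: ifP => [kr|/negbT kr]; last first.
  rewrite /stair_ratio; suff -> : altdet n (n + a) (decr x k) = 0 by ring.
  (* Either lowering makes two variables equal, or [n = 0] and the lowest variable becomes 0 while
     all exponents are positive. *)
  move: kN kr yk {ratioE D0 xk0}; case: (nat_of_ord k) => [|k'] kN /=; rewrite -leqNgt.
    move=> ny yk; have [n0 y0] : n = 0%N /\ y 0%N = 1%N by lia.
    rewrite n0 add0n in kN *; case: (a) kN => // a' _.
    by apply: altdet0_col0; rewrite /decr /x y0 eqxx subrr.
  move=> yk _; apply: (@altdet_eq_col _ _ _ _ k' k'.+1); first by rewrite ltnSn.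
  rewrite /decr eqxx ltn_eqF // subr0 /x.
  have -> : y k'.+1 = (y k').+1 by have := yP.2 k' kN; lia.
  by rewrite -natr1 addrK.
rewrite stair_shape_remove // ratioE (fact_decr k kN).
have cardk : #|` stair_shape (n + a) a (decrn y k)| = s.
  rewrite -stair_shape_remove //.
  have := cardfsD1 (row_end (n + a) y k) (stair_shape (n + a) a y).
  rewrite Es; have : row_end (n + a) y k \in
      [seq row_end (n + a) y k | k <- iota 0 (n + a) & removable n y k].
    by apply: map_f; rewrite mem_filter kr mem_iota add0n kN.
  by rewrite -mem_corners // => /andP[-> _] [->].
suff -> : (num_SYT (stair_shape (n + a) a (decrn y k)))%:R =
    s`!%:R / \prod_(i < n + a) (decrn y k i)`!%:R
    * stair_ratio n (n + a) (fun i => (decrn y k i)%:R) :> rat.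
  move: (stair_ratio _ _ _) => w; by field; rewrite xk0 D0.
case: (ltnP 1 (y k)) => yk1.
  by apply: IHs => //; apply: strict_pos_decrn kr yk1.
(* The bottom row is a single cell and disappears. Removability gives [n > 0], so the induction
   hypothesis applies to [n - 1] and one row fewer. *)
have yk_1 : y k = 1%N by lia.
have k0 : nat_of_ord k = 0%N.
  by have := strict_pos_ge yP kN; lia.
rewrite k0 in kr yk_1 cardk *; move: kr; rewrite /= yk_1 => npos.
case: n npos yP cardk {IHs Es pn0 P x1 xD xdecr fact_decr P0 cardp ratioE D0 k
  kN yk xk0 yk1 k0} (IHs) => [//|n] _ yP cardk IHs.
have d0 : decrn y 0 0 = 0%N by rewrite /decrn yk_1.
have dS i : decrn y 0 i.+1 = y i.+1 by rewrite /decrn subn0.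
rewrite addSn in yP cardk *.
rewrite (@stair_ratioS_col0 _ n (n + a) (fun i => (decrn y 0 i)%:R)) ?d0 //; last first.
  by move=> i iN; rewrite dS pnatr_eq0 -lt0n; apply: yP.1.
rewrite big_ord_recl /= d0 fact0 mul1r stair_shape_col0 //.
rewrite stair_shape_col0 // in cardk.
apply: IHs => //; split=> i iN; rewrite !dS; first exact: yP.1.
exact: yP.2.
Qed.

(** * Shifted hook lengths, row by row *)

Local Arguments shifted_hook : simpl never.

(** Both sides are [(c + 1)(c + 2) ... (c + d + 1)]. *)
Lemma prod_shift_telescope c d :
  ((\prod_(t < d) (c + d - t).+1) * c.+1 =
   (\prod_(t < d) (c + d - t)) * (c + d).+1)%N.
Proof.
elim: d => [|d IHd]; first by rewrite !big_ord0 addn0.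
rewrite !big_ord_recl /= subn0.
have E (t : 'I_d) : (c + d.+1 - bump 0 t = c + d - t)%N.
  by rewrite /bump add1n; lia.
rewrite (eq_bigr (fun t : 'I_d => (c + d - t).+1)) => [|t _]; last by rewrite E.
rewrite [in RHS](eq_bigr (fun t : 'I_d => c + d - t)%N) => [|t _]; last exact: E.
by rewrite addnS -mulnA IHd; ring.
Qed.

(* The hooks of a row of length [M] whose lower rows have lengths
   [m (k - 1) >= ... >= m 0], together with the numbers [M + k - m l - l],
   are exactly [1, ..., M + k]. *)
Lemma prod_hook_row k (m : nat -> nat) M :
    (forall i j, (i <= j < k)%N -> (m i <= m j)%N) ->
    (forall i, (i < k)%N -> (m i <= M)%N) ->
  ((\prod_(t < M) (M - t + \sum_(l < k) (t < m l)))
   * \prod_(l < k) (M + k - m l - l) = (M + k)`!)%N.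
Proof.
elim: k m => [|k IHk] m mono mM.
  rewrite big_ord0 muln1 addn0 fact_prod big_add1 /= big_mkord.
  rewrite [RHS](reindex_inj rev_ord_inj); apply: eq_bigr => t _ /=.
  by rewrite big_ord0 addn0; have := ltn_ord t; lia.
rewrite addnS factS -(IHk (fun l => m l.+1)); last 2 first.
- by move=> i j ij; apply: mono; lia.
- by move=> i ik; apply: mM.
rewrite [X in (_ * X)%N]big_ord_recl /= subn0.
have -> : (\prod_(i < k) ((M + k).+1 - m (bump 0 i) - bump 0 i) =
    \prod_(l < k) (M + k - m l.+1 - l))%N.
  by apply: eq_bigr => l _; rewrite /bump add1n; lia.
rewrite !mulnA; congr (_ * _)%N.
have m0M : (m 0 <= M)%N by apply: mM.
(* All lower rows meet the columns [t < m 0], where the hook is [c + m 0 - t] without the shortest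
   row and one more with it; the other columns do not meet that row. *)
pose c := (M - m 0 + k)%N.
have split (f : nat -> nat) : (\prod_(t < M) f t =
   (\prod_(t < m 0) f t) * \prod_(m 0 <= t < M) f t)%N.
  by rewrite -!(big_mkord xpredT f) -big_cat_nat.
rewrite (split (fun t => M - t + \sum_(l < k.+1) (t < m l))%N).
rewrite (split (fun t => M - t + \sum_(l < k) (t < m l.+1))%N).
have -> : (\prod_(m 0 <= t < M) (M - t + \sum_(l < k.+1) (t < m l)) =
    \prod_(m 0 <= t < M) (M - t + \sum_(l < k) (t < m l.+1)))%N.
  rewrite !big_nat; apply: eq_bigr => t /andP[mt _].
  by rewrite big_ord_recl ltnNge mt.
have -> : (\prod_(t < m 0) (M - t + \sum_(l < k.+1) (t < m l)) =
    \prod_(t < m 0) (c + m 0 - t).+1)%N.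
  apply: eq_bigr => t _; rewrite (eq_bigr (fun=> 1%N)) => [|l _].
    by rewrite sum1_card card_ord /c; have := ltn_ord t; lia.
  by rewrite (leq_trans (ltn_ord t)) //; apply: mono; exact: ltn_ord.
have -> : (\prod_(t < m 0) (M - t + \sum_(l < k) (t < m l.+1)) =
    \prod_(t < m 0) (c + m 0 - t))%N.
  apply: eq_bigr => t _; rewrite (eq_bigr (fun=> 1%N)) => [|l _].
    by rewrite sum1_card card_ord /c; have := ltn_ord t; lia.
  by rewrite (leq_trans (ltn_ord t)) //; apply: mono; exact: ltn_ord.
have := prod_shift_telescope c (m 0).
have -> : ((c + m 0).+1 = (M + k).+1)%N by rewrite /c; lia.
have -> : (c.+1 = (M + k).+1 - m 0)%N by rewrite /c; lia.
move=> E; rewrite mulnAC E; ring.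
Qed.

Lemma part_unshift N y i : (0 < i <= N)%N ->
  part (unshift (parts N y)) i = (y (N - i) - (N - i).+1)%N.
Proof.
move=> iN; rewrite /unshift size_parts {1}/part (nth_map 0%N) ?size_iota; last by lia.
rewrite nth_iota; last by lia.
have -> : (1 + i.-1 = i)%N by lia.
rewrite part_parts // part_delta; last by lia.
by congr (_ - _)%N; lia.
Qed.

Lemma conj_part_unshift N y t : conj_part (unshift (parts N y)) t =
  (\sum_(l < N) (t <= y l - l.+1))%N.
Proof.
rewrite /conj_part -sum1_count /unshift size_parts big_map big_mkcond /= iota1E.
rewrite big_add1 big_nat_rev /= -(big_mkord xpredT (fun l => (t <= y l - l.+1)%N : nat)).
rewrite !big_nat; apply: eq_bigr => l /andP[_ lN]; rewrite add0n.
rewrite part_parts ?part_delta; try by lia.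
have -> : (N - (N - l.+1).+1 = l)%N by lia.
have -> : (N.+1 - (N - l.+1).+1 = l.+1)%N by lia.
by case: leq.
Qed.

Lemma shifted_hook_diag N y k : strict_pos N y -> (k < N)%N ->
  shifted_hook (parts N y) (N - k, N - k)%N = y k.
Proof.
move=> yP kN; rewrite /shifted_hook eqxx size_parts part_unshift; last by lia.
by have := strict_pos_ge yP kN; rewrite subKn; lia.
Qed.

Lemma shifted_hook_pair N y k l : strict_pos N y -> (l < k < N)%N ->
  shifted_hook (parts N y) (N - k, N - l)%N = (y k + y l)%N.
Proof.
move=> yP lkN; rewrite /shifted_hook size_parts.
have -> : (N - k == N - l)%N = false by lia.
have -> : (N - l <= N)%N by lia.
rewrite !part_unshift; try by lia.
have := @strict_pos_ge N y k yP; have := @strict_pos_ge N y l yP.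
by rewrite !subKn; lia.
Qed.

(** The [N - k] rows with [l >= k] all reach this column and cancel the row number, so only the rows
    below are counted. *)
Lemma shifted_hook_free N y k t : strict_pos N y -> (k < N)%N ->
    (t < y k - k.+1)%N ->
  shifted_hook (parts N y) (N - k, N.+1 + t)%N =
  (y k - k.+1 - t + \sum_(l < k) (t < y l - l.+1))%N.
Proof.
move=> yP kN tk; rewrite /shifted_hook size_parts.
have -> : (N - k == N.+1 + t)%N = false by lia.
have -> : (N.+1 + t <= N)%N = false by lia.
have -> : (N.+1 + t - N = t.+1)%N by lia.
rewrite /hook part_unshift ?conj_part_unshift; last by lia.
rewrite -(big_mkord xpredT (fun l => (t < y l - l.+1)%N : nat)).
rewrite (big_cat_nat (n := k)) ?(ltnW kN) //= big_mkord.
have -> : (\sum_(k <= l < N) (t < y l - l.+1) = N - k)%N.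
  rewrite big_nat (eq_bigr (fun=> 1%N)) => [|l /andP[kl lN]].
    by rewrite -big_nat sum_nat_const_nat muln1.
  have gap := strict_pos_gap yP kl lN; have -> : (t < y l - l.+1)%N by lia.
  by [].
by rewrite subKn ?(ltnW kN) //=; move: (\sum_(l < k) _)%N => S; lia.
Qed.

(** The row consists of the diagonal hook [y k], the hooks [y k + y l] and ordinary hooks of the
    unshifted partition; by [prod_hook_row] the latter and the [y k - y l] have the product
    [(y k - 1)!]. *)
Lemma prod_shifted_hook_row N y k : strict_pos N y -> (k < N)%N ->
  ((\prod_(N - k <= j < N - k + y k) shifted_hook (parts N y) ((N - k)%N, j))
   * \prod_(l < k) (y k - y l) = (y k)`! * \prod_(l < k) (y k + y l))%N.
Proof.
move=> yP kN; have yk := strict_pos_ge yP kN.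
rewrite (big_cat_nat (n := N.+1)) /=; try by lia.
rewrite big_ltn; last by lia.
rewrite shifted_hook_diag //.
have -> : (\prod_((N - k).+1 <= j < N.+1) shifted_hook (parts N y) ((N - k)%N, j) =
    \prod_(l < k) (y k + y l))%N.
  rewrite big_add1 /= -{1}[(N - k)%N]add0n big_addn subKn ?(ltnW kN) //.
  rewrite big_nat_rev /= -(big_mkord xpredT (fun l => y k + y l)%N) !big_nat.
  apply: eq_bigr => l /andP[_ lk]; rewrite -(shifted_hook_pair (l := l) yP) ?lk //.
  by congr (shifted_hook _ (_, _)); lia.
have -> : (\prod_(N.+1 <= j < N - k + y k) shifted_hook (parts N y) ((N - k)%N, j) =
    \prod_(t < y k - k.+1) (y k - k.+1 - t + \sum_(l < k) (t < y l - l.+1)))%N.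
  rewrite -{1}[N.+1]add0n big_addn.
  have -> : (N - k + y k - N.+1 = y k - k.+1)%N by lia.
  rewrite big_mkord; apply: eq_bigr => t _.
  by rewrite -(shifted_hook_free yP kN) // addnC.
have [M ME] : exists M, y k = (M + k).+1 by exists (y k - k.+1)%N; lia.
have := @prod_hook_row k (fun l => y l - l.+1)%N M.
have -> : (M = y k - k.+1)%N by lia.
(* The complementary numbers of [prod_hook_row] are the differences of the parts. *)
have -> : (\prod_(l < k) (y k - k.+1 + k - (y l - l.+1) - l) =
    \prod_(l < k) (y k - y l))%N.
  apply: eq_bigr => l _; have lN := ltn_trans (ltn_ord l) kN.
  by have := strict_pos_ge yP lN; have := ltn_ord l; lia.
move=> H.
have -> : (y k)`! = (y k * (y k - k.+1 + k)`!)%N.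
  by rewrite {1}ME factS -ME; congr (_ * _`!)%N; lia.
rewrite -H; last 2 first.
- move=> i j /andP[ij jk]; have := strict_pos_gap yP ij (ltn_trans jk kN).
  by have := strict_pos_ge yP (leq_ltn_trans ij (ltn_trans jk kN)); lia.
- move=> i ik; have := strict_pos_gap yP (ltnW ik) kN; lia.
ring.
Qed.

(** This trades the factorials and pair sums in [num_SYT_stair] for hook lengths. *)
Lemma prod_shifted_hook (F : numFieldType) N y : strict_pos N y ->
  (\prod_(c <- shifted_diagram (parts N y)) (shifted_hook (parts N y) c)%:R)
  * pairprod N (fun i j => (y i)%:R - (y j)%:R) =
  (\prod_(i < N) (y i)`!%:R) * pairprod N (fun i j => (y i)%:R + (y j)%:R) :> F.
Proof.
move=> yP; rewrite prod_shifted_diagram size_parts big_add1 big_nat_rev /=.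
rewrite big_mkord /pairprod -!big_split; apply: eq_bigr => k _ /=.
have kN := ltn_ord k.
have -> : (0 + N - k.+1).+1 = (N - k)%N by lia.
rewrite part_parts ?subKn //; try by lia.
have := prod_shifted_hook_row yP kN => /(congr1 (fun z => z%:R : F)).
rewrite !natrM !natr_prod => H; transitivity
  ((\prod_(N - k <= j < N - k + y k) (shifted_hook (parts N y) ((N - k)%N, j))%:R)
   * \prod_(l < k) (y k - y l)%:R : F).
  congr (_ * _); apply: eq_bigr => l _; rewrite natrB //.
  by have := strict_pos_gap yP (ltnW (ltn_ord l)) kN; lia.
by rewrite H; congr (_ * _); apply: eq_bigr => l _; rewrite natrD.
Qed.

(** * Parts in arithmetic progression and the product formula *)

Lemma lam_parts n a b m : (0 < m)%N ->
  lam n a b m = parts (n + a) (fun i => b.+1 + m * i)%N.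
Proof.
case: m => // m _; apply/eq_in_map => k; rewrite mem_iota => kN.
by rewrite subn1 mulSn; lia.
Qed.

Lemma strict_pos_progression N b m : (0 < m)%N ->
  strict_pos N (fun i => b.+1 + m * i)%N.
Proof. by move=> m0; split=> i _; rewrite ?mulnS; lia. Qed.

Lemma mem_Dcells n a i j :
  ((i, j) \in Dcells n a) = (0 < i <= a)%N && (n + i <= j <= n + a)%N.
Proof.
rewrite !inE; apply/allpairsPdep/andP => [[k [l [kn ln [-> ->]]]] | [iN ij]].
  by move: kn ln; rewrite !mem_iota; lia.
by exists i, (j - n)%N; rewrite !mem_iota; split; try (congr pair); lia.
Qed.

Lemma prod_Dcells (R : comPzRingType) n a (f : nat * nat -> R) :
  \prod_(c <- Dcells n a) f c =
  \prod_(k < a) \prod_(l < k.+1) f ((a - k)%N, (n + (a - l))%N).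
Proof.
rewrite (perm_big _ (_ : perm_eq (Dcells n a)
  [seq (i, (n + j)%N) | i <- iota 1 a, j <- iota i (a + 1 - i)])) /=; last first.
  apply: uniq_perm; rewrite ?fset_uniq //; last by move=> c; rewrite !inE.
  apply: allpairs_uniq_dep => [|i _|[i j] [k l] _ _ /= [-> /addnI->] //];
  exact: iota_uniq.
rewrite big_allpairs_dep iota1E big_add1 big_nat_rev /= big_mkord.
apply: eq_bigr => k _; have ka := ltn_ord k.
have -> : (0 + a - k.+1).+1 = (a - k)%N by lia.
rewrite -[iota _ _]/(iota (a - k) _).
have -> : iota (a - k) (a + 1 - (a - k)) = index_iota (a - k) a.+1.
  by rewrite /index_iota addn1.
rewrite -[X in index_iota X _]add0n big_addn big_nat_rev.
have -> : (a.+1 - (a - k) = k.+1)%N by lia.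
by rewrite big_mkord; apply: eq_bigr => l _; congr (f (_, _)); have := ltn_ord l; lia.
Qed.

Lemma prod_fsetD (T : choiceType) (R : comPzRingType) (A B : {fset T}) (f : T -> R) :
  B `<=` A -> \prod_(c <- A) f c = \prod_(c <- A `\` B) f c * \prod_(c <- B) f c.
Proof.
move=> /fsubsetP BA; rewrite -big_cat; apply: perm_big; apply: uniq_perm.
- exact: fset_uniq.
- rewrite cat_uniq !fset_uniq /= andbT; apply/hasPn => c cB.
  by rewrite /= in_fsetD cB.
- move=> c; rewrite mem_cat in_fsetD; case cB: (c \in B) => /=; last by rewrite orbF.
  exact: BA.
Qed.

Theorem theorem4p1 (n a b m : nat) (hm : (1 <= m)%N)
    (hna : (1 <= n)%N \/ a = 0%N) :
  let la := lam n a b m in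
  let p := shifted_skew la (delta a.+1) in
  (num_SYT p)%:R =
    ((#|` p|)`!)%:R / 2%:R ^+ a
    * ((Phi (n + 2 * a))%:R * (Phi a)%:R
       / ((Phi (2 * a))%:R * (Phi (n + a))%:R))
    * ((gimel (2 * a))%:R * (gimel n)%:R / (gimel (n + 2 * a))%:R)
    * \prod_(c <- shifted_diagram la `\` Dcells n a)
        (1 / (shifted_hook la c)%:R) :> rat.
Proof.
pose y i := (b.+1 + m * i)%N; have yP := strict_pos_progression (n + a) b hm.
rewrite /= lam_parts // -/(stair_shape (n + a) a y) num_SYT_stair //.
set la := parts (n + a) y; pose h c : rat := (shifted_hook la c)%:R.
pose x i : rat := (y i)%:R; move: (_`!%:R) => s.
have DA : Dcells n a `<=` shifted_diagram la.
  apply/fsubsetP => -[i j]; rewrite mem_Dcells mem_shifted_diagram size_parts.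
  move=> /andP[ia ja]; have iN : (0 < i <= n + a)%N by lia.
  rewrite part_parts // iN /=.
  by have := @strict_pos_ge _ y (n + a - i) yP; lia.
(* Numbered from the bottom, a cell of [Dcells n a] pairs the rows [n + k] and [l] with [l <= k]. By
   [hna] these differ, so the hook is the sum of two parts. *)
have QE : \prod_(c <- Dcells n a) h c =
    \prod_(i < a) \prod_(j < i.+1) (x (n + i)%N + x j).
  rewrite prod_Dcells; apply: eq_bigr => k _; apply: eq_bigr => l _.
  have ka := ltn_ord k; have := ltn_ord l; rewrite ltnS => lk.
  rewrite /x -natrD -(shifted_hook_pair yP); last by case: hna; lia.
  by rewrite /h; congr ((shifted_hook _ (_, _))%:R); lia.
have xE i : x i = progression b.+1%:R m%:R i.
  by rewrite /x /y /progression natrD natrM.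
have detE := @altdet_progression_pairs rat n a b.+1%:R m%:R.
rewrite /= -(eq_altdet _ (fun i _ => xE i)) in detE.
rewrite -(@eq_pairprod _ _ (fun i j => x i - x j)) in detE; last first.
  by move=> i j _; rewrite !xE.
have QE' : \prod_(i < a) \prod_(j < i.+1)
   (progression b.+1%:R m%:R (n + i)%N + progression b.+1%:R m%:R j) =
   \prod_(c <- Dcells n a) h c.
  by rewrite QE; apply: eq_bigr => i _; apply: eq_bigr => j _; rewrite !xE.
rewrite {}QE' in detE.
have hookE := @prod_shifted_hook rat _ _ yP; rewrite -/la in hookE.
rewrite (prod_fsetD _ DA) in hookE.
have /(congr1 (fun k => k%:R : rat)) gimelE := Phi_gimel n a.
rewrite !natrM in gimelE detE.
have V0 : pairprod (n + a) (fun i j => x i - x j) != 0.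
  apply: pairprod_neq0 => i j /andP[ji iN].
  rewrite subr_eq0 eqr_nat; have := strict_pos_gap yP (ltnW ji) iN.
  by rewrite -/(y i) -/(y j); lia.
have P0 : pairprod (n + a) (fun i j => x i + x j) != 0.
  apply: pairprod_neq0 => i j /andP[ji iN].
  by rewrite -natrD pnatr_eq0 /y; lia.
have Y0 : \prod_(i < n + a) (y i)`!%:R != 0 :> rat.
  by apply/prodf_neq0 => i _; rewrite pnatr_eq0 -lt0n fact_gt0.
have Phi0 k : (Phi k)%:R != 0 :> rat.
  by rewrite pnatr_eq0 -lt0n prodn_gt0 // => i; exact: fact_gt0.
have gimel0 k : (gimel k)%:R != 0 :> rat.
  by rewrite pnatr_eq0 -lt0n prodn_gt0 // => i; exact: fact_gt0.
have two0 : (2 : rat) ^+ a != 0 by rewrite expf_neq0.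
have -> : \prod_(c <- shifted_diagram la `\` Dcells n a) (1 / (shifted_hook la c)%:R)
   = (\prod_(c <- shifted_diagram la `\` Dcells n a) h c)^-1.
  by rewrite -prodfV; apply: eq_bigr => c _; rewrite div1r.
(* From here on all quantities are abstract scalars: [H] and [Q] are the hook products outside and
   inside [Dcells n a], [V] and [P] the products of differences and sums, [D] the alternant, [Y] the
   factorials, [K] the double product, [t] the power of 2. *)
move: hookE detE gimelE V0 P0 Y0 two0 (Phi0 (2 * a)%N) (Phi0 (n + a)%N)
  (gimel0 (n + 2 * a)%N).
rewrite /stair_ratio -[X in X * _ * _ = _]/(\prod_(c <- _) h c).
rewrite -[X in _ * X * _ = _]/(\prod_(c <- _) h c).
rewrite -[pairprod _ _ in X in X = _]/(pairprod _ (fun i j => x i - x j)).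
rewrite -[pairprod _ _ in X in _ = X]/(pairprod _ (fun i j => x i + x j)).
rewrite -[\prod_(i < n + a) _ in X in _ = X]/(\prod_(i < n + a) (y i)`!%:R).
move: (\prod_(c <- _ `\` _) h c) (\prod_(c <- Dcells n a) h c) => H Q.
move: (pairprod _ (fun i j => x i - x j)) => V.
rewrite -[pairprod _ (fun i j => x i + x j)]/(pairprod (n + a)
  (fun i j => (y i)%:R + (y j)%:R)).
move: (pairprod _ _) (altdet _ _ _) (\prod_(i < n + a) _) => P D Y.
move: (2 ^+ a) (Phi (n + 2 * a))%:R (Phi a)%:R (Phi (2 * a))%:R (Phi (n + a))%:R.
move: (Phi n)%:R (gimel (2 * a))%:R (gimel n)%:R (gimel (n + 2 * a))%:R.
move: (\prod_(t < n) _)%:R => K Fn g2a gn gN t F2 Fa F2a FN hookE detE gimelE.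
move=> V0 P0 Y0 t0 F2a0 FN0 gN0.
have : H * Q * V != 0 by rewrite hookE mulf_neq0.
rewrite !mulf_eq0 !negb_or => /andP[/andP[H0 Q0] _].
(* On the left, [V], [P], [Y] and [Q] cancel; what remains is matched with the right by
   [Phi_gimel]. *)
transitivity (s * Fn * Fa * K / (t * FN * H)).
  have -> : D = D * FN / FN by rewrite mulfK.
  rewrite detE; transitivity
    (s * (V * (Fn * Fa * K) / t * Q / FN) / (Y * P)).
    by field; rewrite Y0 P0 t0 FN0.
  by rewrite -hookE; field; rewrite H0 Q0 V0 t0 FN0.
transitivity (s * Fa * (F2 * g2a * gn) / (t * F2a * FN * gN * H)); last first.
  by field; rewrite t0 F2a0 FN0 gN0 H0.
by rewrite gimelE; field; rewrite t0 F2a0 FN0 gN0 H0.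
Qed.
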